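(* Consider the Discontinuous Galerkin (DG) method of tensor-product degree $K$ for two-dimensional linear acoustics with central flux (diffusion $D_x=D_y=\mathrm{diag}(0,0,1)$ is added in the pressure only, which does not change the discrete steady states of the pure central flux $D_x=D_y=0$). Let $\mathcal E$ be its evolution matrix, take $\Delta y=\Delta x$, and let $\hat Q=(-k_y,k_x,0)^{\mathrm T}$, a stationary Fourier mode of the PDE. The kernel of $\mathcal E$ has dimension $(K+1)^2$. (K=1) $\ker\mathcal E$ is spanned by the four vectors $w_1,\dots,w_4$ listed in the context. Any selectively optimal projector $\pi_{\mathbf k}$ onto $\ker\mathcal E$ based on the entries 5–8 (the degrees of freedom of $v$) yields $$\widehat{\mathrm{DOF}}(\hat Q)-\pi_{\mathbf k}\widehat{\mathrm{DOF}}(\hat Q)=\Big(0,\,-\tfrac{\mathrm i\,\Delta x\,k_y^2}{2\sqrt3},\,-\tfrac{\mathrm i\,\Delta x\,k_xk_y}{6\sqrt3},\,0\,\Big|\,0,0,0,0\,\Big|\,0,0,0,0\Big)^{\mathrm T}+\mathcal O(\Delta x^2).$$ Thus central DG for $K=1$ is at most first-order, and not second-order, accurate at stationary state. (K=2) $\ker\mathcal E$ is spanned by the nine vectors $w_1,\dots,w_9$ listed in the context. As long as $a_6=a_7=0$ in the selectively optimal projector $$\begin{aligned}\pi_{\mathbf k}\hat q:={}&(q_{v^{(22)}}+a_0\Delta x^3)w_1+(q_{v^{(21)}}+a_1\Delta x^3)w_2+(q_{v^{(20)}}+a_2\Delta x^3)w_3\\&+(q_{v^{(12)}}+a_3\Delta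 x^3)w_4+\dots+(q_{v^{(00)}}+a_8\Delta x^3)w_9,\end{aligned}$$ one has $\widehat{\mathrm{DOF}}(\hat Q)-\pi_{\mathbf k}\widehat{\mathrm{DOF}}(\hat Q)\in\mathcal O(\Delta x^3)$. Thus it is theoretically possible that DG with central flux achieves optimal (third-order) accuracy at stationary state. (K=3) No accuracy better than third order can be achieved at stationary state, i.e. one order less than optimal.
   Context: Linear acoustics in 2D, $q=(u,v,p)$: $\partial_tq+J_x\partial_xq+J_y\partial_yq=0$ with $$J_x=\begin{pmatrix}0&0&1\\0&0&0\\1&0&0\end{pmatrix},\qquad J_y=\begin{pmatrix}0&0&0\\0&0&1\\0&1&0\end{pmatrix}.$$ The vector $\hat Q=(-k_y,k_x,0)^{\mathrm T}$ lies in $\ker(J_xk_x+J_yk_y)$. Basis: $b_0,\dots,b_K$ is the orthonormal polynomial basis on $[-\frac12,\frac12]$: $1,\ 2\sqrt3x,\ \frac{\sqrt5}2(12x^2-1),\ \sqrt7x(20x^2-3),\dots$, so that the mass matrix is $M^k_\alpha=\delta_{k\alpha}$. Put $G^k_\alpha=\int_{-1/2}^{1/2}b_k'(\xi)b_\alpha(\xi)\,d\xi$. Numerical fluxes: $\hat f^x(q_L,q_R)=J_x\frac{q_L+q_R}2-D_x\frac{q_R-q_L}2$, and $\hat f^y$ analogously with $J_y,D_y$. Evolution matrix: let $t_x=e^{\mathrm ik_x\Delta x}$, $t_y=e^{\mathrm ik_y\Delta y}$. On a Cartesian grid with cell sizes $\Delta x,\Delta y$, inserting the discrete Fourier mode $q^{(\alpha\beta)}_{ij}(t)=\hat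 q^{(\alpha\beta)}(t)t_x^it_y^j$, $\hat q^{(\alpha\beta)}\in\mathbb C^3$, for the coefficients of $b_\alpha(x/\Delta x)b_\beta(y/\Delta y)$ in cell $(i,j)$ (coordinates relative to the cell centre) into the semi-discrete DG method gives $\frac{d}{dt}\hat q^{(k\ell)}+\sum_{\alpha,\beta=0}^K\mathcal E^{k\ell}_{\alpha\beta}\hat q^{(\alpha\beta)}=0$, with $3\times3$ blocks $$\begin{aligned}\mathcal E^{k\ell}_{\alpha\beta}=&-\tfrac1{\Delta x}J_xM^\ell_\beta G^k_\alpha-\tfrac1{\Delta y}J_yM^k_\alpha G^\ell_\beta\\&+\frac{b_k(\frac12)t_x-b_k(-\frac12)}{t_x\Delta x}\left(J_x\frac{b_\alpha(\frac12)+t_xb_\alpha(-\frac12)}2-D_x\frac{t_xb_\alpha(-\frac12)-b_\alpha(\frac12)}2\right)M^\ell_\beta\\&+\frac{b_\ell(\frac12)t_y-b_\ell(-\frac12)}{t_y\Delta y}\left(J_y\frac{b_\beta(\frac12)+t_yb_\beta(-\frac12)}2-D_y\frac{t_yb_\beta(-\frac12)-b_\beta(\frac12)}2\right)M^k_\alpha.\end{aligned}$$ These blocks form $\mathcal E\in\mathbb C^{3(K+1)^2\times3(K+1)^2}$. Entries of vectors are ordered as all $u^{(\alpha\beta)}$, then all $v^{(\alpha\beta)}$, then all $p^{(\alpha\beta)}$, each lexicographically in $(\alpha,\beta)$. $q_{v^{(\alpha\beta)}}$ is the entry of $\hat q$ belonging to $v^{(\alpha\beta)}$. Degrees of freedom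 of the Fourier mode $\hat Qe^{\mathrm i\mathbf k\cdot\mathbf x}$: $$\widehat{\mathrm{DOF}}(\hat Q)_{k\ell}=\hat Q\,\frac1{\Delta x\Delta y}\int_{-\Delta x/2}^{\Delta x/2}\int_{-\Delta y/2}^{\Delta y/2}b_k\big(\tfrac x{\Delta x}\big)b_\ell\big(\tfrac y{\Delta y}\big)e^{\mathrm ik_xx}e^{\mathrm ik_yy}\,dy\,dx.$$ Selectively optimal projector: a projector $\pi_{\mathbf k}:\mathbb C^{3(K+1)^2}\to S_{\mathbf k}\subset\mathbb C^{3(K+1)^2}$ (here $S_{\mathbf k}=\ker\mathcal E$) such that there is an index set $I$ with $\#I=\dim S_{\mathbf k}$ and $(\pi_{\mathbf k}\hat q)_i=\hat q_i+\mathcal O(\Delta x^{K+1})$ for all $i\in I$ and all $\hat q$. It is said to be based on the entries in $I$. (The word projector is also used for affine maps such as the one displayed for $K=2$.) A loss of accuracy at stationary state is demonstrated by showing that no selectively optimal projector gives optimal order $K+1$ in all components of $\pi_{\mathbf k}\widehat{\mathrm{DOF}}(\hat Q)$. Existence of one that does is only a necessary condition for optimal order of the stationary states. Kernel bases. Abbreviate $\rho=\frac{\Delta x}{\Delta y}$, $X=\frac{1+t_x}{t_x-1}$, $r=\frac{(t_y-1)^2}{4t_y}$, $s=\frac{(1+t_y)^2}{4t_y}$, $\tau=\frac{t_y^2-1}{4t_y}$. In every vector below all $p$-entries vanish, and among the $v$-entries only the indicated one is nonzero and equals $1$. The $u$-entries are as listed. $K=1$: - $w_1$ ($v^{(11)}=1$):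 $\rho(-r,-\sqrt3\tau,-\frac{Xr}{\sqrt3},-X\tau)$ - $w_2$ ($v^{(10)}=1$): $\rho(\frac{\tau}{\sqrt3},r,\frac{X\tau}3,\frac{Xr}{\sqrt3})$ - $w_3$ ($v^{(01)}=1$): $\rho(\sqrt3Xr,3X\tau,r,\sqrt3\tau)$ - $w_4$ ($v^{(00)}=1$): $\rho(-X\tau,-\sqrt3Xr,-\frac\tau{\sqrt3},-r)$ $K=2$: - $w_1$ ($v^{(22)}=1$): $\rho(0,0,0,\frac\tau{\sqrt3},s,\sqrt{\frac53}\tau,\frac{\tau}{\sqrt5X},\sqrt{\frac35}\frac sX,\frac\tau X)$ - $w_2$ ($v^{(21)}=1$): $\rho(0,0,0,-\frac r{\sqrt5},-\sqrt{\frac35}\tau,-s,-\frac{\sqrt3r}{5X},-\frac{3\tau}{5X},-\sqrt{\frac35}\frac sX)$ - $w_3$ ($v^{(20)}=1$): $\rho(0,0,0,\frac\tau{\sqrt{15}},\frac r{\sqrt5},\frac\tau{\sqrt3},\frac\tau{5X},\frac{\sqrt3r}{5X},\frac\tau{\sqrt5X})$ - $w_4$ ($v^{(12)}=1$): $\rho(\sqrt{\frac53}\tau,\sqrt5s,\frac{5\tau}{\sqrt3},0,0,0,-\frac\tau{\sqrt3},-s,-\sqrt{\frac53}\tau)$ - $w_5$ ($v^{(11)}=1$): $\rho(-r,-\sqrt3\tau,-\sqrt5s,0,0,0,\frac r{\sqrt5},\sqrt{\frac35}\tau,s)$ - $w_6$ ($v^{(10)}=1$): $\rho(\frac\tau{\sqrt3},r,\sqrt{\frac53}\tau,0,0,0,-\frac\tau{\sqrt{15}},-\frac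 r{\sqrt5},-\frac\tau{\sqrt3})$ - $w_7$ ($v^{(02)}=1$): $\rho(-\sqrt5X\tau,-\sqrt{15}Xs,-5X\tau,-\sqrt{\frac53}\tau,-\sqrt5s,-\frac{5\tau}{\sqrt3},0,0,0)$ - $w_8$ ($v^{(01)}=1$): $\rho(\sqrt3Xr,3X\tau,\sqrt{15}Xs,r,\sqrt3\tau,\sqrt5s,0,0,0)$ - $w_9$ ($v^{(00)}=1$): $\rho(-X\tau,-\sqrt3Xr,-\sqrt5X\tau,-\frac\tau{\sqrt3},-r,-\sqrt{\frac53}\tau,0,0,0)$
   Formalization: Generic k is assumed: t_x or t_y must differ from 1 (and from −1 for even K) for the kernel dimension and flux claim, t_x likewise for the spanning vectors; k_x≠0 in the asymptotic claims, and also k_y≠0 in the negative results for K=1 and K=3, which fail for grid-aligned modes. *)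

(* Defs.v *)
From HB Require Import structures.
From mathcomp Require Import all_boot all_order all_algebra.
From mathcomp Require Import all_classical all_reals all_analysis.
From mathcomp Require Import complex.

Set Implicit Arguments.
Unset Strict Implicit.
Unset Printing Implicit Defensive.

Import Order.TTheory GRing.Theory Num.Theory.
Import numFieldNormedType.Exports.

Local Open Scope ring_scope.
Local Open Scope complex_scope.
Local Open Scope classical_set_scope.

Section Integrals.
Variable R : realType.

Definition rint (x y : R) (f : R -> R) : R :=
  Rintegral lebesgue_measure `[x, y] f.

Definition cint (x y : R) (f : R -> R[i]) : R[i] :=
  rint x y (fun s => complex.Re (f s)) +i* rint x y (fun s => complex.Im (f s)).

Definition expi (x : R) : R[i] := cos x +i* sin x.

End Integrals.

Section Basis.
Variables (R : realType) (b : nat -> {poly R}).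

Definition mass (k a : nat) : R :=
  rint (- 2^-1) 2^-1 (fun x => (b k).[x] * (b a).[x]).

Definition stiff (k a : nat) : R :=
  rint (- 2^-1) 2^-1 (fun x => (b k)^`().[x] * (b a).[x]).

(* Together these conditions determine every [b k]; the sign of the leading
   coefficient is the one of 1, 2 sqrt 3 x, sqrt 5 / 2 (12 x^2 - 1), ... *)
Definition orthonormal_basis : Prop :=
  [/\ forall k, size (b k) = k.+1,
      forall k, 0 < lead_coef (b k)
    & forall k l, mass k l = (k == l)%:R].

End Basis.

Section DegreesOfFreedom.
Variable K : nat.

Definition ndof : nat := (3 * (K.+1 * K.+1))%N.

Lemma modes_lt (k l : 'I_K.+1) : (k * K.+1 + l < K.+1 * K.+1)%N.
Proof.
apply: (@leq_trans (k.+1 * K.+1)%N); first by rewrite mulSnr ltn_add2l.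
by rewrite leq_mul2r ltn_ord orbT.
Qed.

Lemma dof_subproof (c : 'I_3) (k l : 'I_K.+1) :
  (c * (K.+1 * K.+1) + (k * K.+1 + l) < ndof)%N.
Proof.
apply: (@leq_trans (c.+1 * (K.+1 * K.+1))%N).
  by rewrite (mulSnr c) ltn_add2l modes_lt.
by rewrite leq_mul2r ltn_ord orbT.
Qed.

(* Position of the coefficient of b_k(x) b_l(y) in the component c of (u, v, p):
   all u, then all v, then all p, each lexicographically in (k, l). *)
Definition dof (c : 'I_3) (k l : 'I_K.+1) : 'I_ndof :=
  Ordinal (dof_subproof c k l).

(* [dof] is inverted by the next three functions. *)
Definition field_of (i : 'I_ndof) : 'I_3 := inord (i %/ (K.+1 * K.+1))%N.
Definition xmode (i : 'I_ndof) : nat := ((i %% (K.+1 * K.+1)) %/ K.+1)%N.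
Definition ymode (i : 'I_ndof) : nat := (i %% K.+1)%N.

Lemma field_of_dof c k l : field_of (dof c k l) = c.
Proof.
by apply: val_inj; rewrite /field_of /= divnMDl // divn_small ?modes_lt // addn0 inordK.
Qed.

Lemma xmode_dof c k l : xmode (dof c k l) = k.
Proof.
by rewrite /xmode /= modnMDl modn_small ?modes_lt // divnMDl // divn_small // addn0.
Qed.

Lemma ymode_dof c k l : ymode (dof c k l) = l.
Proof. by rewrite /ymode /= mulnA addnA -mulnDl modnMDl modn_small. Qed.

Definition v_entries : {set 'I_ndof} := [set i | field_of i == 1].

End DegreesOfFreedom.

Section Acoustics.
Variable R : realType.
Local Notation C := R[i].

Definition mx3 (rows : seq (seq C)) : 'M[C]_3 :=
  \matrix_(i, j) nth 0 (nth [::] rows i) j.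

Definition Jx : 'M[C]_3 := mx3 [:: [:: 0; 0; 1];
                                   [:: 0; 0; 0];
                                   [:: 1; 0; 0]].

Definition Jy : 'M[C]_3 := mx3 [:: [:: 0; 0; 0];
                                   [:: 0; 0; 1];
                                   [:: 0; 1; 0]].

Definition Dp : 'M[C]_3 := mx3 [:: [:: 0; 0; 0];
                                   [:: 0; 0; 0];
                                   [:: 0; 0; 1]].

Definition Qhat (kx ky : R) : 'cV[C]_3 :=
  \col_i nth 0 [:: (- ky)%:C; kx%:C; 0] i.

Section Scheme.
Variables (b : nat -> {poly R}) (K : nat).
Variables (Dx Dy : 'M[C]_3) (dx dy kx ky : R).

Let bp k : C := (b k).[2^-1]%:C.
Let bm k : C := (b k).[- 2^-1]%:C.
Let tx := expi (kx * dx).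
Let ty := expi (ky * dy).

(* Block of the test function b_k(x) b_l(y) and the coefficient of b_a(x) b_c(y). *)
Definition evol_block (k l a c : nat) : 'M[C]_3 :=
  - ((dx%:C)^-1 * (mass b l c)%:C * (stiff b k a)%:C) *: Jx
  - ((dy%:C)^-1 * (mass b k a)%:C * (stiff b l c)%:C) *: Jy
  + ((bp k * tx - bm k) / (tx * dx%:C) * (mass b l c)%:C) *:
      (((bp a + tx * bm a) / 2) *: Jx - ((tx * bm a - bp a) / 2) *: Dx)
  + ((bp l * ty - bm l) / (ty * dy%:C) * (mass b k a)%:C) *:
      (((bp c + ty * bm c) / 2) *: Jy - ((ty * bm c - bp c) / 2) *: Dy).

Definition evol_mx : 'M[C]_(ndof K) :=
  \matrix_(i, j) evol_block (xmode i) (ymode i) (xmode j) (ymode j)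
                            (field_of i) (field_of j).

Definition steady : {vspace 'cV[C]_(ndof K)} := lker (linfun (mulmx evol_mx)).

End Scheme.

Definition DOF (b : nat -> {poly R}) (K : nat) (dx dy kx ky : R) :
    'cV[C]_(ndof K) :=
  \col_i (Qhat kx ky (field_of i) 0 * ((dx * dy)^-1)%:C *
    cint (- (dx / 2)) (dx / 2) (fun x =>
      cint (- (dy / 2)) (dy / 2) (fun y =>
        ((b (xmode i)).[x / dx] * (b (ymode i)).[y / dy])%:C *
        expi (kx * x) * expi (ky * y)))).

(* The central-flux derivative matrix in one direction is singular exactly at
   t = 1 and, for even K, at t = -1 (checkerboard mode). *)
Definition regular_mode (K : nat) (t : C) : bool :=
  (t != 1) && (odd K || (t != -1)).

Definition scal_bigO (e : R -> C) (p : R) : Prop :=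
  exists c : R, \forall h \near (0 : R)^'+, `|e h| <= (c * h `^ p)%:C.

Definition vec_bigO (n : nat) (e : R -> 'cV[C]_n) (p : R) : Prop :=
  forall i : 'I_n, scal_bigO (fun h => e h i 0) p.

Definition affine_map (n : nat) (f : 'cV[C]_n -> 'cV[C]_n) : Prop :=
  exists (A : 'M[C]_n) (c : 'cV[C]_n), forall q, f q = A *m q + c.

(* [S h] and [P h] are the subspace and the projector for cell size h. "Projector"
   includes affine maps such as [proj2] below, which are not idempotent, so
   idempotence is not required. *)
Definition selectively_optimal (K : nat)
    (S : R -> {vspace 'cV[C]_(ndof K)}) (I : {set 'I_(ndof K)})
    (P : R -> 'cV[C]_(ndof K) -> 'cV[C]_(ndof K)) : Prop :=
  [/\ \forall h \near (0 : R)^'+, #|I| = \dim (S h),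
      \forall h \near (0 : R)^'+, affine_map (P h) /\ forall q, P h q \in S h
    & forall q i, i \in I -> scal_bigO (fun h => P h q i 0 - q i 0) K.+1%:R].

Section KernelVectors.
Variables (dx dy kx ky : R).
Let tx := expi (kx * dx).
Let ty := expi (ky * dy).
Let rho : C := (dx / dy)%:C.
Let X : C := (1 + tx) / (tx - 1).
Let r : C := (ty - 1) ^+ 2 / (4 * ty).
Let s : C := (1 + ty) ^+ 2 / (4 * ty).
Let tau : C := (ty ^+ 2 - 1) / (4 * ty).
Let sq (x : R) : C := (Num.sqrt x)%:C.

(* u-entries rho * us, v^(k l) = 1, all other entries 0 *)
Definition kvec (K k l : nat) (us : seq C) : 'cV[C]_(ndof K) :=
  \col_i (if field_of i == 0 then rho * nth 0 us i
          else if field_of i == 1 then ((xmode i == k) && (ymode i == l))%:R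
          else 0).

Definition w1 : seq 'cV[C]_(ndof 1) :=
  [:: kvec 1 1 1 [:: - r; - (sq 3 * tau); - (X * r / sq 3); - (X * tau)];
      kvec 1 1 0 [:: tau / sq 3; r; X * tau / 3; X * r / sq 3];
      kvec 1 0 1 [:: sq 3 * X * r; 3 * X * tau; r; sq 3 * tau];
      kvec 1 0 0 [:: - (X * tau); - (sq 3 * X * r); - (tau / sq 3); - r]].

Definition w2 : seq 'cV[C]_(ndof 2) :=
  [:: kvec 2 2 2 [:: 0; 0; 0;
        tau / sq 3; s; sq (5 / 3) * tau;
        tau / (sq 5 * X); sq (3 / 5) * (s / X); tau / X];
      kvec 2 2 1 [:: 0; 0; 0;
        - (r / sq 5); - (sq (3 / 5) * tau); - s;
        - (sq 3 * r / (5 * X)); - (3 * tau / (5 * X)); - (sq (3 / 5) * (s / X))];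
      kvec 2 2 0 [:: 0; 0; 0;
        tau / sq 15; r / sq 5; tau / sq 3;
        tau / (5 * X); sq 3 * r / (5 * X); tau / (sq 5 * X)];
      kvec 2 1 2 [:: sq (5 / 3) * tau; sq 5 * s; 5 * tau / sq 3;
        0; 0; 0;
        - (tau / sq 3); - s; - (sq (5 / 3) * tau)];
      kvec 2 1 1 [:: - r; - (sq 3 * tau); - (sq 5 * s);
        0; 0; 0;
        r / sq 5; sq (3 / 5) * tau; s];
      kvec 2 1 0 [:: tau / sq 3; r; sq (5 / 3) * tau;
        0; 0; 0;
        - (tau / sq 15); - (r / sq 5); - (tau / sq 3)];
      kvec 2 0 2 [:: - (sq 5 * X * tau); - (sq 15 * X * s); - (5 * X * tau);
        - (sq (5 / 3) * tau); - (sq 5 * s); - (5 * tau / sq 3);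
        0; 0; 0];
      kvec 2 0 1 [:: sq 3 * X * r; 3 * X * tau; sq 15 * X * s;
        r; sq 3 * tau; sq 5 * s;
        0; 0; 0];
      kvec 2 0 0 [:: - (X * tau); - (sq 3 * X * r); - (sq 5 * X * tau);
        - (tau / sq 3); - r; - (sq (5 / 3) * tau);
        0; 0; 0]].

End KernelVectors.

(* (2,2), (2,1), (2,0), (1,2), ..., (0,0): the order of the vectors in [w2] *)
Definition proj2 (a : 'I_9 -> C) (kx ky h : R) (q : 'cV[C]_(ndof 2)) :
    'cV[C]_(ndof 2) :=
  let w j := nth 0 (w2 h h kx ky) j in
  let qv k l := q (dof 1 k l) 0 in
  let h3 := (h ^+ 3)%:C in
    (qv 2 2 + a 0 * h3) *: w 0%N + (qv 2 1 + a 1 * h3) *: w 1%N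
  + (qv 2 0 + a 2 * h3) *: w 2%N + (qv 1 2 + a 3 * h3) *: w 3%N
  + (qv 1 1 + a 4 * h3) *: w 4%N + (qv 1 0 + a 5 * h3) *: w 5%N
  + (qv 0 2 + a 6 * h3) *: w 6%N + (qv 0 1 + a 7 * h3) *: w 7%N
  + (qv 0 0 + a 8 * h3) *: w 8%N.

Definition leading1 (kx ky h : R) : 'cV[C]_(ndof 1) :=
  \col_i nth 0 [:: 0;
                   - ('i%C * (h * ky ^+ 2)%:C / (2 * (Num.sqrt 3)%:C));
                   - ('i%C * (h * kx * ky)%:C / (6 * (Num.sqrt 3)%:C));
                   0;
                   0; 0; 0; 0;
                   0; 0; 0; 0] i.

End Acoustics.

(* Main.v *)
(** The kernel consists of the vectors with vanishing pressure and
    [A(t_x) U / dx + V A(t_y)^T / dy = 0], where [U], [V] are the matrices of the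
    coefficients of u, v and [A(t)] is the one-dimensional central derivative
    matrix. [A(t)] is invertible for regular modes, so the kernel is the graph of a
    linear map in [V] (or in [U]).

    The moments [m] of a plane wave satisfy, by integration by parts,
    [A m = i k h m + e] with [e_j = (b_j(1/2) - b_j(-1/2) / t) * defect]. The defect
    comes from the [b_(K+1)] component of the wave: it is of exact order h^(K+1)
    for K odd, and O(h^(K+2)) for K even because the contributions from the two
    sides of the interface cancel to leading order. This makes the stationary
    error third order for K = 2 and produces the first-order term for K = 1; for
    odd K the entry of the balance equation tested with [b_0(x) b_K(y)] excludes
    any order higher than K. *)

From HB Require Import structures.
Require Import Defs.
From mathcomp Require Import all_boot all_order all_algebra.
From mathcomp Require Import all_classical all_reals all_analysis.
From mathcomp Require Import complex ring lra.

Import Order.TTheory GRing.Theory Num.Theory.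
Import numFieldNormedType.Exports.

Local Open Scope ring_scope.
Local Open Scope complex_scope.

Set Implicit Arguments.
Unset Strict Implicit.
Unset Printing Implicit Defensive.

(** The obstacle is a pole. For K = 1 and K = 2 the inverse of [A(t)] grows like 1 / h as t tends to
    1, so solving for the u coefficients can cost an order of accuracy. The estimates keep account
    of where this order is regained: row 0 is a flux difference and column 0 a jump, hence both are
    O(h); the residual tested with [b 0] gains one order; for K = 2 the pole sits in a single entry
    of the inverse. The order barrier for odd K avoids the inverse and tests one row of the balance
    equation directly. All constants originate in the endpoint values of the basis. They are derived
    from [orthonormal_basis] alone: integration by parts and parity give [b k] the value sqrt(2 k +
    1) at 1/2, and this determines the stiffness matrix, the derivative matrix and the leading
    coefficients. Remainders are bounded without sharp constants, since only powers of h are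
    compared. *)

Section Integration.

(** * Integrals of complex-valued functions on an interval *)

Variable R : realType.
Local Notation C := R[i].
Implicit Types (x y k : R) (f g : R -> C) (p q : {poly R}).

Lemma continuous_integrable_itv x y (f : R -> R) : continuous f ->
  (@lebesgue_measure R).-integrable `[x, y]%classic (EFin \o f).
Proof.
move=> cf; apply: continuous_compact_integrable; first exact: segment_compact.
exact: continuous_subspaceT.
Qed.

Lemma rint_FTC x y (f F : R -> R) : x < y -> continuous f ->
  (forall z : R, is_derive z 1 F (f z)) -> rint x y f = F y - F x.
Proof.
move=> xy cf dF; have cF : continuous F.
  by move=> z; apply/differentiable_continuous/derivable1_diffP; case: (dF z).
rewrite /rint /Rintegral (@continuous_FTC2 _ f F) //.
- exact: continuous_subspaceT.
- split=> [z _||]; first by case: (dF z).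
  + by apply: cvg_at_right_filter; exact: cF.
  + by apply: cvg_at_left_filter; exact: cF.
- by move=> z _; rewrite derive1E; case: (dF z).
Qed.

Lemma rint_deriv x y p : x < y -> rint x y (horner p^`()) = p.[y] - p.[x].
Proof. by move=> xy; apply: rint_FTC => //; exact: continuous_horner. Qed.

(** Stated for the two real components because [cint] integrates them separately. *)
Definition ccont f :=
  continuous (fun s => complex.Re (f s)) /\ continuous (fun s => complex.Im (f s)).

Lemma cintD x y f g : ccont f -> ccont g ->
  cint x y (fun s => f s + g s) = cint x y f + cint x y g.
Proof.
move=> [cf cf'] [cg cg']; rewrite /cint /rint; simpc; congr (_ +i* _).
- rewrite -RintegralD//; try exact: continuous_integrable_itv.
  by apply: eq_Rintegral => s _; rewrite raddfD.
- rewrite -RintegralD//; try exact: continuous_integrable_itv.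
  by apply: eq_Rintegral => s _; rewrite raddfD.
Qed.

Lemma continuousB_fun (f g : R -> R) : continuous f -> continuous g ->
  continuous (fun s => f s - g s).
Proof. by move=> cf cg z; apply: cvgB; [exact: cf|exact: cg]. Qed.
Lemma continuousD_fun (f g : R -> R) : continuous f -> continuous g ->
  continuous (fun s => f s + g s).
Proof. by move=> cf cg z; apply: cvgD; [exact: cf|exact: cg]. Qed.
Lemma continuousM_fun (f g : R -> R) : continuous f -> continuous g ->
  continuous (fun s => f s * g s).
Proof. by move=> cf cg z; apply: cvgM; [exact: cf|exact: cg]. Qed.

Lemma ReM (z w : C) :
  complex.Re (z * w) = complex.Re z * complex.Re w - complex.Im z * complex.Im w.
Proof. by case: z => a b; case: w. Qed.

Lemma ImM (z w : C) :
  complex.Im (z * w) = complex.Re z * complex.Im w + complex.Im z * complex.Re w.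
Proof. by case: z => a b; case: w => c d; rewrite /= [b * c]mulrC. Qed.

Lemma ccontM f g : ccont f -> ccont g -> ccont (fun s => f s * g s).
Proof.
move=> [cf cf'] [cg cg']; split.
- rewrite (_ : (fun s => _) = fun s => complex.Re (f s) * complex.Re (g s) -
     complex.Im (f s) * complex.Im (g s)); last by apply/funext => s; exact: ReM.
  by apply: continuousB_fun; exact: continuousM_fun.
- rewrite (_ : (fun s => _) = fun s => complex.Re (f s) * complex.Im (g s) +
     complex.Im (f s) * complex.Re (g s)); last by apply/funext => s; exact: ImM.
  by apply: continuousD_fun; exact: continuousM_fun.
Qed.

Lemma ccontD f g : ccont f -> ccont g -> ccont (fun s => f s + g s).
Proof.
move=> [cf cf'] [cg cg']; split.
- rewrite (_ : (fun s => _) = fun s => complex.Re (f s) + complex.Re (g s)).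
    exact: continuousD_fun.
  by apply/funext => s; rewrite raddfD.
- rewrite (_ : (fun s => _) = fun s => complex.Im (f s) + complex.Im (g s)).
    exact: continuousD_fun.
  by apply/funext => s; rewrite raddfD.
Qed.

Lemma ccont_cst (z : C) : ccont (fun=> z).
Proof. by split=> s; exact: cvg_cst. Qed.

Lemma ccont_real (f : R -> R) : continuous f -> ccont (fun s => (f s)%:C).
Proof. by move=> cf; split => [//|s]; exact: cvg_cst. Qed.

Lemma ccont_expi k : ccont (fun s => expi (k * s)).
Proof.
have ck : continuous (fun s : R => k * s).
  by move=> s; apply: cvgM; [exact: cvg_cst|exact: cvg_id].
split=> s /=.
- by apply: (@continuous_comp _ _ _ (fun s : R => k * s) cos); [exact: ck|exact: continuous_cos].
- by apply: (@continuous_comp _ _ _ (fun s : R => k * s) sin); [exact: ck|exact: continuous_sin].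
Qed.

Lemma ccont_sum n (F : 'I_n -> R -> C) : (forall i, ccont (F i)) ->
  ccont (fun s => \sum_i F i s).
Proof.
elim: n F => [F _|n IH F cF].
  under [X in ccont X]eq_fun do rewrite big_ord0; exact: ccont_cst.
under [X in ccont X]eq_fun do rewrite big_ord_recr/=.
by apply: ccontD => //; apply: IH.
Qed.

Lemma cintZ x y (z : C) f : ccont f ->
  cint x y (fun s => z * f s) = z * cint x y f.
Proof.
move=> [cf cf']; rewrite /cint /rint.
have cM (a : R) (h : R -> R) : continuous h -> continuous (fun s => a * h s).
  by move=> ch; apply: continuousM_fun => // s; exact: cvg_cst.
rewrite [RHS]/GRing.mul/=; case: z => a b /=; congr (_ +i* _).
- rewrite -!RintegralZl ?continuous_integrable_itv// -RintegralB//;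
    try (apply: continuous_integrable_itv; exact: cM).
  by apply: eq_Rintegral => s _; rewrite ReM.
- rewrite -!RintegralZl ?continuous_integrable_itv// -RintegralD//;
    try (apply: continuous_integrable_itv; exact: cM).
  by apply: eq_Rintegral => s _; rewrite ImM.
Qed.

Lemma cint_sum x y n (F : 'I_n -> R -> C) : (forall i, ccont (F i)) ->
  cint x y (fun s => \sum_i F i s) = \sum_i cint x y (F i).
Proof.
elim: n F => [F _|n IH F cF].
  (* The empty sum is written as a product so that [cintZ] evaluates its integral. *)
  rewrite big_ord0 (_ : (fun s => _) = (fun s : R => 0 * 0 : C)).
    by rewrite cintZ ?mul0r//; exact: ccont_cst.
  by apply/funext => s; rewrite big_ord0 mul0r.
rewrite big_ord_recr/= -IH// -cintD//; last exact: ccont_sum.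
by congr cint; apply/funext => s; rewrite big_ord_recr.
Qed.

Lemma cint_real x y (f : R -> R) : cint x y (fun s => (f s)%:C) = (rint x y f)%:C.
Proof.
by rewrite /cint/=; congr (_ +i* _); rewrite /rint Rintegral_cst// mul0r.
Qed.

Lemma cint_FTC x y f (F : R -> C) : x < y -> ccont f ->
  (forall z : R, is_derive z 1 (fun s => complex.Re (F s)) (complex.Re (f z))) ->
  (forall z : R, is_derive z 1 (fun s => complex.Im (F s)) (complex.Im (f z))) ->
  cint x y f = F y - F x.
Proof.
move=> xy [cf cf'] dF dF'; rewrite /cint (rint_FTC xy cf dF) (rint_FTC xy cf' dF').
by case: (F y) => a b; case: (F x).
Qed.

Lemma rint_le_sup x y (f : R -> R) (M : R) : x <= y -> continuous f ->
  (forall s, x <= s <= y -> `|f s| <= M) -> `|rint x y f| <= M * (y - x).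
Proof.
move=> xy cf fM; rewrite /rint.
apply: (le_trans (le_normr_Rintegral _ _)) => //; first exact: continuous_integrable_itv.
have -> : M * (y - x) = \int[lebesgue_measure]_(s in `[x, y]) (cst M s).
  rewrite Rintegral_cst//=; congr (_ * _).
  rewrite (_ : fine _ = fine (@lebesgue_measure R `[x, y]%classic))//.
  rewrite lebesgue_measure_itv/= lte_fin.
  by case: ltgtP xy => // -> _; rewrite subrr.
apply: le_Rintegral => //.
- apply: continuous_integrable_itv => s.
  by apply: (@continuous_comp _ _ _ f Num.norm); [exact: cf|exact: norm_continuous].
- by apply: continuous_integrable_itv => s; exact: cvg_cst.
Qed.

Lemma norm_i : `|'i%C| = 1 :> C.
Proof. by rewrite normc_def/= expr0n add0r expr1n sqrtr1. Qed.

Lemma normcR (a : R) : `|a%:C| = `|a|%:C.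
Proof. by rewrite normc_def/= expr0n addr0 sqrtr_sqr. Qed.

Lemma normc_le_ReIm (z : C) : `|z| <= (`|complex.Re z| + `|complex.Im z|)%:C.
Proof.
case: z => a b /=; have -> : a +i* b = a%:C + 'i%C * b%:C by simpc.
rewrite rmorphD/= (le_trans (ler_normD _ _))// normrM norm_i mul1r.
by rewrite !normcR.
Qed.

(** Multiplication by ['i%C] preserves the modulus and moves the imaginary part, up to sign, into
    the real part. *)
Lemma normc_ge_Im (z : C) : `|complex.Im z|%:C <= `|z|.
Proof.
rewrite -[X in _ <= X]mulr1 -norm_i -normrM; apply: le_trans (normc_ge_Re _).
by rewrite ReiNIm normrN.
Qed.

(** The factor 2 comes from bounding the real and imaginary parts separately. *)
Lemma cint_le_sup x y f (M : R) : x <= y -> ccont f ->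
  (forall s, x <= s <= y -> `|f s| <= M%:C) ->
  `|cint x y f| <= (2 * M * (y - x))%:C.
Proof.
move=> xy [cf cf'] fM; apply: (le_trans (normc_le_ReIm _)); rewrite lecR /=.
have -> : 2 * M * (y - x) = M * (y - x) + M * (y - x) by ring.
apply: lerD; apply: rint_le_sup => // s /fM; rewrite -lecR; apply: le_trans.
- exact: normc_ge_Re.
- exact: normc_ge_Im.
Qed.

End Integration.

(** * Orthogonality, parity and derivatives of the basis polynomials *)

Section OrthonormalBasis.
Variables (R : realType) (b : nat -> {poly R}).
Hypothesis hb : orthonormal_basis b.
Implicit Types p q : {poly R}.

Definition pint p : R := rint (- 2^-1) 2^-1 (horner p).

Lemma half_itv_lt : - 2^-1 < 2^-1 :> R.
Proof. by rewrite ltrNl; lra. Qed.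

Lemma pint_deriv p : pint p^`() = p.[2^-1] - p.[- 2^-1].
Proof. by rewrite /pint rint_deriv// half_itv_lt. Qed.

(** Every polynomial being a derivative, identities for [pint] reduce to endpoint evaluations and
    carry no integrability side conditions. *)
Lemma ex_antideriv p : exists q, q^`() = p.
Proof.
(* At i = 0 the quotient is a division by zero, hence 0; differentiation discards this
   coefficient. *)
exists (\poly_(i < (size p).+1) (p`_i.-1 / i%:R)).
apply/polyP => i; rewrite coef_deriv coef_poly /= ltnS.
case: ltnP => ip; last by rewrite mul0rn nth_default.
by rewrite -[LHS]mulr_natr -mulrA mulVf ?mulr1// pnatr_eq0.
Qed.

Lemma pintD p q : pint (p + q) = pint p + pint q.
Proof.
have [p' <-] := ex_antideriv p; have [q' <-] := ex_antideriv q.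
by rewrite -derivD !pint_deriv !hornerD; ring.
Qed.

Lemma pintZ c p : pint (c *: p) = c * pint p.
Proof.
have [p' <-] := ex_antideriv p.
by rewrite -derivZ !pint_deriv !hornerZ; ring.
Qed.

Lemma pintN p : pint (- p) = - pint p.
Proof. by rewrite -scaleN1r pintZ mulN1r. Qed.

Lemma pintB p q : pint (p - q) = pint p - pint q.
Proof. by rewrite pintD pintN. Qed.

Lemma pint0 : pint 0 = 0.
Proof. by rewrite -(scale0r 0) pintZ mul0r. Qed.

Lemma pint_sum n (F : 'I_n -> {poly R}) : pint (\sum_i F i) = \sum_i pint (F i).
Proof.
elim: n F => [|n IH] F; first by rewrite !big_ord0 pint0.
by rewrite !big_ord_recr pintD IH.
Qed.

Lemma pint_compN p : pint (p \Po (- 'X)) = pint p.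
Proof.
have [q <-] := ex_antideriv p.
have -> : q^`() \Po - 'X = (- (q \Po - 'X))^`().
  by rewrite derivN deriv_comp derivN derivX mulrN1 opprK.
rewrite [LHS]pint_deriv [RHS]pint_deriv !hornerN !horner_comp !hornerN !hornerX.
by rewrite !opprK addrC.
Qed.

Lemma massE k l : mass b k l = pint (b k * b l).
Proof. by rewrite /mass /pint; congr rint; apply/funext => x; rewrite hornerM. Qed.

Lemma stiffE k l : stiff b k l = pint ((b k)^`() * b l).
Proof. by rewrite /stiff /pint; congr rint; apply/funext => x; rewrite hornerM. Qed.

Lemma size_basis k : size (b k) = k.+1. Proof. by case: hb. Qed.
Lemma lead_basis_gt0 k : 0 < lead_coef (b k). Proof. by case: hb. Qed.
Lemma basis_orthonormal k l : pint (b k * b l) = (k == l)%:R.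
Proof. by rewrite -massE; case: hb. Qed.

Lemma lead_basisE k : lead_coef (b k) = (b k)`_k.
Proof. by rewrite /lead_coef size_basis. Qed.

Lemma coef_basis_neq0 k : (b k)`_k != 0.
Proof. by rewrite -lead_basisE gt_eqF// lead_basis_gt0. Qed.

(** The induction step of Gram-Schmidt type arguments: matching the top coefficient with a multiple
    of [b n] lowers the degree. *)
Lemma size_sub_basis n q : (size q <= n.+1)%N ->
  (size (q - (q`_n / (b n)`_n) *: b n)%R <= n)%N.
Proof.
move=> sq; apply/leq_sizeP => j; rewrite leq_eqVlt => /predU1P[<-|nj].
  by rewrite coefB coefZ divfK ?coef_basis_neq0// subrr.
rewrite coefB coefZ [q`_j]nth_default ?(leq_trans sq nj)//.
by rewrite [(b n)`_j]nth_default ?size_basis// mulr0 subrr.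
Qed.

Lemma basis_orth k q : (size q <= k)%N -> pint (b k * q) = 0.
Proof.
(* The degree bound is separated from k so that the induction lowers it while [b k] stays fixed. *)
suff: forall n, (n <= k)%N -> (size q <= n)%N -> pint (b k * q) = 0.
  by move=> + sq; apply; [exact: leqnn|].
move=> n; elim: n q => [|n IH] q nk sq.
  by move: sq; rewrite leqn0 size_poly_eq0 => /eqP ->; rewrite mulr0 pint0.
have -> : q = (q - (q`_n / (b n)`_n) *: b n) + (q`_n / (b n)`_n) *: b n by rewrite subrK.
rewrite mulrDr pintD IH ?size_sub_basis// ?(ltnW nk)// -scalerAr pintZ.
by rewrite basis_orthonormal gtn_eqF// mulr0 addr0.
Qed.

Lemma basis_expansion n q : (size q <= n)%N -> q = \sum_(a < n) pint (b a * q) *: b a.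
Proof.
elim: n q => [|n IH] q sq.
  by rewrite big_ord0; apply/eqP; rewrite -size_poly_eq0 -leqn0.
pose c := q`_n / (b n)`_n; pose r := q - c *: b n.
have sr : (size r <= n)%N by exact: size_sub_basis.
have qE : q = r + c *: b n by rewrite subrK.
clearbody r c.
rewrite big_ord_recr /= {1}qE; congr (_ + _ *: _).
- rewrite {1}(IH r sr); apply: eq_bigr => a _; congr (_ *: _).
  rewrite qE mulrDr pintD -scalerAr pintZ basis_orthonormal.
  by rewrite ltn_eqF ?ltn_ord// mulr0 addr0.
- by rewrite qE mulrDr pintD basis_orth// -scalerAr pintZ basis_orthonormal eqxx mulr1 add0r.
Qed.

Lemma basis_orth_eq0 n q : (size q <= n)%N ->
  (forall a, (a < n)%N -> pint (b a * q) = 0) -> q = 0.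
Proof.
by move=> sq h; rewrite (basis_expansion sq) big1// => a _; rewrite h// scale0r.
Qed.

Lemma size_compN p : size (p \Po (- 'X)) = size p.
Proof. by rewrite size_comp_poly2// size_polyN size_polyX. Qed.

(** Reflection preserves the integral over the symmetric interval, so the reflected [b k] is still
    orthogonal to all lower degrees and is a multiple of [b k]; comparing leading coefficients gives
    the sign. *)
Lemma basis_parity k : b k \Po (- 'X) = (-1) ^+ k *: b k.
Proof.
apply/eqP; rewrite -subr_eq0; apply/eqP.
apply: (@basis_orth_eq0 k.+1).
  rewrite (leq_trans (size_polyD _ _))// geq_max size_compN size_polyN.
  by rewrite size_basis leqnn/= (leq_trans (size_scale_leq _ _))// size_basis.
move=> a; rewrite ltnS => ak.
rewrite mulrBr pintB -scalerAr pintZ basis_orthonormal.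
have XNN : (- 'X) \Po (- 'X) = 'X :> {poly R}.
  by rewrite raddfN/= comp_polyX opprK.
have flip : pint (b a * (b k \Po - 'X)) = pint (b k * (b a \Po - 'X)).
  rewrite -[LHS]pint_compN comp_polyM -[X in _ * X]comp_polyA XNN comp_polyXr.
  by rewrite mulrC.
have sk : size (b a \Po - 'X) = a.+1 by rewrite size_compN size_basis.
rewrite flip; move: ak; rewrite leq_eqVlt => /predU1P[ak|ak]; last first.
  by rewrite (basis_orth (k := k)) ?sk// (ltn_eqF ak) mulr0 subrr.
rewrite ak eqxx mulr1; rewrite ak in sk.
have sk' : (size (b k \Po - 'X) <= k.+1)%N by rewrite sk.
rewrite -[b k \Po - 'X](subrK ((b k \Po - 'X)`_k / (b k)`_k *: b k)) mulrDr pintD.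
rewrite basis_orth ?size_sub_basis// add0r -scalerAr pintZ basis_orthonormal eqxx mulr1.
suff -> : (b k \Po - 'X)`_k = (-1) ^+ k * (b k)`_k by rewrite mulfK ?subrr// coef_basis_neq0.
have -> : - 'X = (-1) *: 'X :> {poly R} by rewrite scaleN1r.
rewrite comp_polyE coef_sum size_basis big_ord_recr/= big1 ?add0r => [|i _].
  by rewrite exprZn coefZ coefZ coefXn eqxx mulr1 mulrC.
by rewrite exprZn coefZ coefZ coefXn gtn_eqF ?mulr0// ltn_ord.
Qed.

Definition bhi k : R := (b k).[2^-1].
Definition blo k : R := (b k).[- 2^-1].

Lemma blo_parity k : blo k = (-1) ^+ k * bhi k.
Proof. by rewrite /blo /bhi -hornerZ -basis_parity horner_comp hornerN hornerX. Qed.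

Lemma stiff_ibp k a : stiff b k a + stiff b a k = bhi k * bhi a - blo k * blo a.
Proof.
rewrite !stiffE -pintD [X in _ + X]mulrC -derivM pint_deriv.
by rewrite !hornerM.
Qed.

Lemma size_deriv_basis k : (size (b k)^`() <= k)%N.
Proof. by rewrite (leq_trans (size_poly _ _))// size_basis. Qed.

Lemma stiff_upper k a : (k <= a)%N -> stiff b k a = 0.
Proof.
move=> ka; rewrite stiffE mulrC basis_orth//.
exact: leq_trans (size_deriv_basis k) ka.
Qed.

Lemma stiff_succ k : stiff b k.+1 k = k.+1%:R * ((b k.+1)`_k.+1 / (b k)`_k).
Proof.
rewrite stiffE -[X in pint (X * _)](subrK (((b k.+1)^`())`_k / (b k)`_k *: b k)).
rewrite mulrC mulrDr pintD basis_orth ?size_sub_basis ?size_deriv_basis// add0r.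
rewrite -scalerAr pintZ basis_orthonormal eqxx mulr1 coef_deriv.
by rewrite -[X in X / _]mulr_natl mulrA.
Qed.

Lemma stiff_succ_neq0 k : stiff b k.+1 k != 0.
Proof.
by rewrite stiff_succ !mulf_neq0// ?invr_eq0 ?coef_basis_neq0// pnatr_eq0.
Qed.

(* Integration by parts writes the nonzero entry [stiff b k.+1 k] as
   [2 * bhi k.+1 * bhi k]. *)
Lemma deriv_basis_expansion k n : (k <= n)%N ->
  (b k)^`() = \sum_(a < n) stiff b k a *: b a.
Proof.
move=> kn; rewrite {1}(@basis_expansion n (b k)^`()).
  by apply: eq_bigr => a _; rewrite stiffE mulrC.
exact: leq_trans (size_deriv_basis k) kn.
Qed.

End OrthonormalBasis.

(** * Closed forms of the endpoint values and of the stiffness matrix *)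

Section BoundaryValues.
Variables (R : realType) (b : nat -> {poly R}).
Hypothesis hb : orthonormal_basis b.

(** Integrate the derivative of ['X * (b k * b k)]. By parity the boundary terms add up to the
    square of the endpoint value. The product rule gives 1 + 2 k, because x times the derivative of
    [b k] has top coefficient k times that of [b k] and lower degrees are orthogonal. *)
Lemma bhi_sqr k : bhi b k ^+ 2 = (k.*2.+1)%:R.
Proof.
have -> : bhi b k ^+ 2 = pint ('X * (b k * b k))^`().
  rewrite pint_deriv !hornerM hornerX -/(bhi b k) -/(blo b k) (blo_parity hb).
  have := sqrr_sign R k; rewrite expr2 => ss.
  by rewrite [X in _ - _ * X]mulrACA ss hornerX; lra.
rewrite derivM derivX mul1r pintD (basis_orthonormal hb) eqxx derivM.
have -> : 'X * ((b k)^`() * b k + b k * (b k)^`()) = 2%:R *: (b k * ('X * (b k)^`())).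
  by rewrite scaler_nat mulr2n; ring.
rewrite pintZ.
have sX : (size ('X * (b k)^`())%R <= k.+1)%N.
  apply: (leq_trans (size_polyMleq _ _)); rewrite size_polyX /=.
  by rewrite -[X in (X <= _)%N]/((size (b k)^`()).+1) ltnS (size_deriv_basis hb).
rewrite -[X in b k * X](subrK (('X * (b k)^`())`_k / (b k)`_k *: b k)) mulrDr pintD.
rewrite (basis_orth hb) ?size_sub_basis// add0r -scalerAr pintZ.
rewrite (basis_orthonormal hb) eqxx mulr1.
have -> : ('X * (b k)^`())`_k = k%:R * (b k)`_k.
  rewrite coefXM; case: (k) => [|n] /=; first by rewrite mul0r.
  by rewrite coef_deriv mulr_natl.
by rewrite mulfK ?(coef_basis_neq0 hb)// -natrM -natrD mul2n.
Qed.

(** Positive leading coefficients make [stiff b k.+1 k] positive, and integration by parts equates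
    it with twice the product of two consecutive endpoint values, so positivity propagates from
    [b 0]. *)
Lemma bhi_gt0 k : 0 < bhi b k.
Proof.
elim: k => [|k IH].
  have s0 := size_basis hb 0; have := lead_basis_gt0 hb 0.
  by rewrite (lead_basisE hb) /bhi [b 0%N]size1_polyC ?s0// coefC hornerC.
have : 0 < bhi b k.+1 * bhi b k.
  have -> : bhi b k.+1 * bhi b k = stiff b k.+1 k / 2.
    have := stiff_ibp b k.+1 k; rewrite [X in _ + X]stiff_upper// addr0 => ->.
    rewrite !(blo_parity hb) exprS mulrACA mulN1r -[in - _ * _]signr_odd mulNr -signr_addb addbb.
    by rewrite mulN1r; lra.
  rewrite divr_gt0// (stiff_succ hb) mulr_gt0// divr_gt0// -(lead_basisE hb).
    exact: lead_basis_gt0.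
  exact: lead_basis_gt0.
by rewrite pmulr_lgt0.
Qed.

Lemma bhiE k : bhi b k = Num.sqrt (k.*2.+1)%:R.
Proof. by rewrite -bhi_sqr sqrtr_sqr gtr0_norm// bhi_gt0. Qed.

(** At least one of the two terms in [stiff_ibp] vanishes by degree, so endpoint values alone
    determine the stiffness matrix. *)
Lemma stiffE_bhi k a : stiff b k a =
  if (a < k)%N then bhi b k * bhi b a * (1 - (-1) ^+ (k + a)) else 0.
Proof.
case: ltnP => [ak|ka]; last by rewrite (stiff_upper hb).
have := stiff_ibp b k a; rewrite [X in _ + X](stiff_upper hb) ?(ltnW ak)// addr0 => ->.
by rewrite !(blo_parity hb) exprD; ring.
Qed.

End BoundaryValues.

(** * The one-dimensional derivative matrix and its invertibility *)

Section DerivativeMatrix.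
Variables (R : realType) (b : nat -> {poly R}).
Hypothesis hb : orthonormal_basis b.
Local Notation C := R[i].
Implicit Type t : C.

Definition chi k : C := (bhi b k)%:C.
Definition clo k : C := (blo b k)%:C.

(** The weak form in one direction: volume term, traces of the test function at both faces, and the
    averaged interface value of the trial function. *)
Definition central_mx K t : 'M[C]_K.+1 := \matrix_(k, a)
  (- (stiff b k a)%:C + (chi k * t - clo k) / t * ((chi a + t * clo a) / 2)).

Lemma clo_parity k : clo k = (-1) ^+ k * chi k.
Proof. by rewrite /clo (blo_parity hb) rmorphM/= rmorphXn rmorphN1. Qed.

Lemma chi_neq0 k : chi k != 0.
Proof. by rewrite /chi (inj_eq (@complexI _)) gt_eqF// bhi_gt0. Qed.

Lemma central_mx_strong K t k a : t != 0 -> central_mx K t k a =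
  (stiff b a k)%:C + (chi k + clo k / t) * ((t * clo a - chi a) / 2).
Proof.
move=> t0; rewrite mxE.
have : (stiff b k a)%:C + (stiff b a k)%:C = chi k * chi a - clo k * clo a.
  by rewrite -rmorphD (stiff_ibp b) rmorphB !rmorphM.
move/(canRL (addrK _)) => ->; field; exact: t0.
Qed.

(* In the strong form of the scheme, testing a null vector with [b K] leaves only
   the interface jump [d], so [d = 0] for a regular mode; the rest of the matrix
   is then strictly triangular up to constants. *)
Lemma central_mx_unit K t : t != 0 -> regular_mode K t -> central_mx K t \in unitmx.
Proof.
move=> t0 /andP[t1 tK]; rewrite -unitmx_tr -row_free_unit.
apply: inj_row_free => v /rowP vA.
pose d := \sum_(a < K.+1) (t * clo a - chi a) / 2 * v 0 a.
have strong (k : 'I_K.+1) : \sum_(a < K.+1) (stiff b a k)%:C * v 0 a + (chi k + clo k / t) * d = 0.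
  have := vA k; rewrite !mxE => vAk; rewrite -[RHS]vAk mulr_sumr -big_split/=.
  by apply: eq_bigr => a _; rewrite [_^T a k]mxE central_mx_strong//; ring.
have d0 : d = 0.
  have := strong ord_max; rewrite big1 ?add0r => [|a _]; last first.
    by rewrite (stiff_upper hb) ?mul0r// -ltnS.
  move/eqP; rewrite mulf_eq0 => /orP[|/eqP//].
  (* The parity of [b K] turns the face factor into 1 - 1 / t for odd K and 1 + 1 / t for even K,
     whence the two cases of [regular_mode]. *)
  rewrite /= clo_parity -signr_odd; have [oK|eK] := boolP (odd K) => h.
  - move: h; rewrite expr1 mulN1r mulNr -[X in X - _]mulr1 -mulrBr mulf_eq0 (negPf (chi_neq0 _))/=.
    by rewrite subr_eq0 eq_sym invr_eq1 (negPf t1).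
  - move: h; rewrite expr0 mul1r -[X in X + _]mulr1 -mulrDr mulf_eq0 (negPf (chi_neq0 _))/=.
    rewrite addrC addr_eq0 -(inj_eq (@invr_inj _)) invrK invrN1.
    by move: tK; rewrite (negPf eK)/= => /negPf ->.
(* The induction descends from a = K. Row a - 1 isolates entry a: larger indices vanish by
   induction, smaller ones by degree. *)
have vpos j : forall a : 'I_K.+1, (0 < a)%N -> (K < a + j)%N -> v 0 a = 0.
  elim: j => [|j IH] a a0; first by rewrite addn0 ltnNge -ltnS ltn_ord.
  rewrite addnS ltnS => Ka; have := strong (inord a.-1); rewrite d0 mulr0 addr0.
  have ap : (a.-1 < K.+1)%N by rewrite (leq_ltn_trans (leq_pred _)).
  rewrite inordK// (bigD1 a)//= big1 ?addr0 => [|i ia].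
    move/eqP; rewrite mulf_eq0 => /orP[|/eqP//].
    by rewrite -{1}(prednK a0) (inj_eq (@complexI _)) (negPf (stiff_succ_neq0 hb _)).
  have [ai|ia'] := ltnP a i.
    by rewrite IH ?mulr0//; [exact: leq_ltn_trans ai|rewrite (leq_ltn_trans Ka)// ltn_add2r].
  have -> : stiff b i a.-1 = 0; last by rewrite mul0r.
  by rewrite (stiff_upper hb)// -ltnS prednK// ltn_neqAle ia.
(* Derivatives do not see the constant mode; it is caught by its interface jump, which is
   proportional to t - 1. *)
have v0 : v 0 0 = 0.
  have := d0; rewrite /d (bigD1 0)//= big1 ?addr0 => [|i i0]; last first.
    by rewrite (vpos K) ?mulr0 ?lt0n// -[X in (X < _)%N]add0n ltn_add2r lt0n.
  move/eqP; rewrite mulf_eq0 => /orP[|/eqP//].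
  rewrite clo_parity expr0 mul1r -[X in _ - X]mul1r -mulrBl mulf_eq0 invr_eq0 pnatr_eq0 orbF.
  by rewrite mulf_eq0 (negPf (chi_neq0 _)) orbF subr_eq0 (negPf t1).
apply/rowP => a; rewrite mxE; have [->//|a0] := eqVneq a 0.
by apply: (vpos K); rewrite ?lt0n// -[X in (X < _)%N]add0n ltn_add2r lt0n.
Qed.

End DerivativeMatrix.

Lemma mx_entryD (V : nmodType) m n (M N : 'M[V]_(m, n)) i j :
  (M + N) i j = M i j + N i j.
Proof. by rewrite mxE. Qed.

Lemma mx_entryN (V : zmodType) m n (M : 'M[V]_(m, n)) i j : (- M) i j = - M i j.
Proof. by rewrite mxE. Qed.

Lemma mx_entryZ (S : pzRingType) m n (a : S) (M : 'M[S]_(m, n)) i j :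
  (a *: M) i j = a * M i j.
Proof. by rewrite mxE. Qed.

(** * Vectors as triples of coefficient matrices for u, v and p *)

Section Components.
Variables (R : realType) (K : nat).
Local Notation C := R[i].
Implicit Types (q : 'cV[C]_(ndof K)) (U V P : 'M[C]_K.+1).

Definition comp (c : 'I_3) q : 'M[C]_K.+1 := \matrix_(k, l) q (dof c k l) 0.

Definition of_comps U V P : 'cV[C]_(ndof K) :=
  \col_i nth 0 [:: U; V; P] (field_of i) (inord (xmode i)) (inord (ymode i)).

Lemma xmode_lt (i : 'I_(ndof K)) : (xmode i < K.+1)%N.
Proof. by rewrite /xmode ltn_divLR// ltn_mod. Qed.

Lemma ymode_lt (i : 'I_(ndof K)) : (ymode i < K.+1)%N.
Proof. by rewrite /ymode ltn_mod. Qed.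

Lemma dofK (i : 'I_(ndof K)) :
  dof (field_of i) (inord (xmode i)) (inord (ymode i)) = i.
Proof.
apply: val_inj; rewrite /= !inordK ?xmode_lt ?ymode_lt//; last first.
  by rewrite ltn_divLR// ltn_ord.
rewrite /xmode /ymode [RHS](divn_eq i (K.+1 * K.+1)); congr (_ + _)%N.
by rewrite [RHS](divn_eq _ K.+1) modn_dvdm// dvdn_mull.
Qed.

Lemma dof_ind (Q : 'I_(ndof K) -> Prop) :
  (forall c k l, Q (dof c k l)) -> forall i, Q i.
Proof. by move=> h i; rewrite -(dofK i). Qed.

Lemma sum_dof (F : 'I_(ndof K) -> C) :
  \sum_i F i = \sum_c \sum_k \sum_l F (dof c k l).
Proof.
pose g (x : 'I_3 * ('I_K.+1 * 'I_K.+1)) := dof x.1 x.2.1 x.2.2.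
rewrite (reindex g) /=; last first.
  exists (fun i => (field_of i, (inord (xmode i), inord (ymode i)))).
    by move=> [c [k l]] _; rewrite /g/= field_of_dof xmode_dof ymode_dof !inord_val.
  by move=> i _; rewrite /g/= dofK.
have h c : \sum_k \sum_l F (dof c k l) =
    \sum_(p : 'I_K.+1 * 'I_K.+1) F (dof c p.1 p.2) by rewrite pair_bigA.
by rewrite (eq_bigr _ (fun c _ => h c)) pair_bigA.
Qed.

Lemma comp_of_comps c U V P : comp c (of_comps U V P) = nth 0 [:: U; V; P] c.
Proof.
by apply/matrixP => k l; rewrite !mxE field_of_dof xmode_dof ymode_dof !inord_val.
Qed.

Lemma comp_inj q q' : (forall c, comp c q = comp c q') -> q = q'.
Proof.
move=> h; apply/colP; apply: dof_ind => c k l.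
by have /matrixP/(_ k l) := h c; rewrite !mxE.
Qed.

Lemma ord3_ind (Q : 'I_3 -> Prop) : Q 0 -> Q 1 -> Q 2 -> forall c, Q c.
Proof.
move=> h0 h1 h2 [[|[|[|//]]] lt].
- by rewrite (_ : Ordinal lt = 0)//; exact: val_inj.
- by rewrite (_ : Ordinal lt = 1)//; exact: val_inj.
- by rewrite (_ : Ordinal lt = 2)//; exact: val_inj.
Qed.

Lemma compD c q q' : comp c (q + q') = comp c q + comp c q'.
Proof. by apply/matrixP => k l; rewrite !mxE. Qed.
Lemma compZ c a q : comp c (a *: q) = a *: comp c q.
Proof. by apply/matrixP => k l; rewrite !mxE. Qed.
Lemma compB c q q' : comp c (q - q') = comp c q - comp c q'.
Proof. by apply/matrixP => k l; rewrite !mxE. Qed.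
Lemma comp0 c : comp c 0 = 0.
Proof. by apply/matrixP => k l; rewrite !mxE. Qed.

End Components.

(** * From the evolution matrix to the balance equation *)

Section Kernel.
Variables (R : realType) (b : nat -> {poly R}).
Hypothesis hb : orthonormal_basis b.
Local Notation C := R[i].

Lemma expi_neq0 (x : R) : expi x != 0.
Proof.
apply/eqP => /(congr1 (fun z => complex.Re z ^+ 2 + complex.Im z ^+ 2)).
by rewrite /= cos2Dsin2 expr0n addr0 => /eqP; rewrite oner_eq0.
Qed.

(** The interface term that multiplies the diffusion matrix. *)
Definition jump_mx K (t : C) : 'M[C]_K.+1 := \matrix_(k, a)
  ((chi b k * t - clo b k) / t * ((chi b a - t * clo b a) / 2)).

Lemma central_mxE K t k a : central_mx b K t k a =
  - (stiff b k a)%:C + (chi b k * t - clo b k) / t * ((chi b a + t * clo b a) / 2).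
Proof. by rewrite mxE. Qed.

Lemma jump_mxE K t k a : jump_mx K t k a =
  (chi b k * t - clo b k) / t * ((chi b a - t * clo b a) / 2).
Proof. by rewrite mxE. Qed.

Section FixedCell.
Variables (K : nat) (dx dy kx ky : R) (d : C).
Hypotheses (dx0 : 0 < dx) (dy0 : 0 < dy).
Let tx := expi (kx * dx).
Let ty := expi (ky * dy).
Local Notation A t := (central_mx b K t).
Local Notation B t := (jump_mx K t).
Local Notation D := (d *: Dp R).

(** The factor [d] treats the pressure diffusion (d = 1) and the pure central flux (d = 0) in one
    computation. *)
Lemma evol_blockE (k l a c : 'I_K.+1) :
  evol_block b D D dx dy kx ky k l a c =
    ((dx%:C)^-1 * (l == c)%:R * A tx k a) *: Jx R
  + ((dy%:C)^-1 * (k == a)%:R * A ty l c) *: Jy R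
  + (d * ((dx%:C)^-1 * (l == c)%:R * B tx k a + (dy%:C)^-1 * (k == a)%:R * B ty l c)) *: Dp R.
Proof.
have massC m n : (mass b m n)%:C = (m == n)%:R by case: hb => _ _ ->; rewrite rmorph_nat.
have dxn : dx%:C != 0 by rewrite (inj_eq (@complexI _)) gt_eqF.
have dyn : dy%:C != 0 by rewrite (inj_eq (@complexI _)) gt_eqF.
rewrite /evol_block !massC -/tx -/ty -/(chi b k) -/(chi b l) -/(chi b a) -/(chi b c).
rewrite -/(clo b k) -/(clo b l) -/(clo b a) -/(clo b c) !val_eqE.
move: (Jx R) (Jy R) (Dp R) (l == c)%:R (k == a)%:R => J1 J2 J3 m m'.
apply/matrixP => i j; rewrite scalerBr !scalerA; rewrite !(mx_entryD, mx_entryZ) !mx_entryN !mx_entryZ.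
rewrite central_mxE central_mxE jump_mxE jump_mxE.
field; rewrite dxn dyn !expi_neq0//.
Qed.

Definition xflux (q : 'cV[C]_(ndof K)) c : 'M[C]_K.+1 := (dx%:C)^-1 *: (A tx *m comp c q).
Definition yflux (q : 'cV[C]_(ndof K)) c : 'M[C]_K.+1 := (dy%:C)^-1 *: (comp c q *m (A ty)^T).
Definition jumps (q : 'cV[C]_(ndof K)) c : 'M[C]_K.+1 :=
  d *: ((dx%:C)^-1 *: (B tx *m comp c q) + (dy%:C)^-1 *: (comp c q *m (B ty)^T)).

(** The Kronecker deltas of the mass matrix decouple the directions: with coefficients stored as
    matrices, x acts by left multiplication and y by right multiplication with a transpose. *)
Lemma evol_comp (q : 'cV[C]_(ndof K)) (c : 'I_3) :
  comp c (evol_mx b K D D dx dy kx ky *m q) = \sum_c'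
   (Jx R c c' *: xflux q c' + Jy R c c' *: yflux q c' + Dp R c c' *: jumps q c').
Proof.
apply/matrixP => k l; rewrite summxE !mxE sum_dof; apply: eq_bigr => c' _.
have lsum (M : 'M[C]_K.+1) (w : C) : w * (M *m comp c' q) k l =
    \sum_a \sum_e (w * (l == e)%:R * M k a) * q (dof c' a e) 0.
  rewrite mxE mulr_sumr; apply: eq_bigr => a _.
  rewrite (bigD1 l)//= eqxx big1 ?addr0 => [|e]; first by rewrite mxE /=; ring.
  by rewrite eq_sym => /negPf ->; rewrite mulr0 !mul0r.
have rsum (M : 'M[C]_K.+1) (w : C) : w * (comp c' q *m M^T) k l =
    \sum_a \sum_e (w * (k == a)%:R * M l e) * q (dof c' a e) 0.
  rewrite mxE mulr_sumr exchange_big/=; apply: eq_bigr => e _.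
  rewrite (bigD1 k)//= eqxx big1 ?addr0 => [|a]; first by rewrite !mxE /=; ring.
  by rewrite eq_sym => /negPf ->; rewrite mulr0 !mul0r.
have lin (X Y Z : 'M[C]_K.+1) (x y z : C) :
    (x *: X + y *: Y + z *: Z) k l = x * X k l + y * Y k l + z * Z k l.
  by rewrite !(mx_entryD, mx_entryZ).
have jE (X Y : 'M[C]_K.+1) (x y : C) : (d *: (x *: X + y *: Y)) k l =
    d * (x * X k l + y * Y k l) by rewrite !(mx_entryD, mx_entryZ).
rewrite lin jE [xflux _ _ _ _]mx_entryZ [yflux _ _ _ _]mx_entryZ !lsum !rsum.
rewrite -!big_split/= !mulr_sumr -!big_split/=.
apply: eq_bigr => a _; rewrite -!big_split/= !mulr_sumr -!big_split/=.
apply: eq_bigr => e _; rewrite [evol_mx _ _ _ _ _ _ _ _ _ _]mxE !field_of_dof !xmode_dof !ymode_dof.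
rewrite evol_blockE; move: (Jx R) (Jy R) (Dp R) => J1 J2 J3.
by rewrite !(mx_entryD, mx_entryZ); ring.
Qed.

Lemma sum_fluxes (X Y Z : 'I_3 -> 'M[C]_K.+1) c :
  \sum_c' (Jx R c c' *: X c' + Jy R c c' *: Y c' + Dp R c c' *: Z c') =
  nth 0 [:: X 2; Y 2; X 0 + Y 1 + Z 2] c.
Proof.
rewrite !big_ord_recl big_ord0.
rewrite (_ : lift _ (lift _ _) = 2); last exact: val_inj.
rewrite (_ : lift _ _ = 1); last exact: val_inj.
rewrite (_ : ord0 = 0); last exact: val_inj.
by elim/ord3_ind: c; rewrite !mxE/= !scale0r !scale1r ?addr0 ?add0r ?addrA.
Qed.

Lemma mem_steadyE (q : 'cV[C]_(ndof K)) :
  (q \in steady b K D D dx dy kx ky) = (evol_mx b K D D dx dy kx ky *m q == 0).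
Proof. by rewrite /steady memv_ker lfunE. Qed.

Hypothesis reg : regular_mode K tx \/ regular_mode K ty.

(** The u and v rows contain only the pressure, so a single invertible direction forces it to
    vanish. The diffusion acts on the pressure alone and disappears with it, for every [d]. *)
Lemma mem_steady (q : 'cV[C]_(ndof K)) : q \in steady b K D D dx dy kx ky <->
  comp 2 q = 0 /\
  (dx%:C)^-1 *: (A tx *m comp 0 q) + (dy%:C)^-1 *: (comp 1 q *m (A ty)^T) = 0.
Proof.
have dxn : (dx%:C)^-1 != 0 by rewrite invr_eq0 (inj_eq (@complexI _)) gt_eqF.
have dyn : (dy%:C)^-1 != 0 by rewrite invr_eq0 (inj_eq (@complexI _)) gt_eqF.
rewrite mem_steadyE; split=> [/eqP Eq|[P0 UV]].
- have ev c := evol_comp q c; rewrite Eq in ev.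
  have /esym/eqP := ev 0; rewrite comp0 sum_fluxes /= scaler_eq0 (negPf dxn)/= => /eqP AP.
  have /esym/eqP := ev 1; rewrite comp0 sum_fluxes /= scaler_eq0 (negPf dyn)/= => /eqP PA.
  have P0 : comp 2 q = 0.
    case: reg => [/(central_mx_unit hb (expi_neq0 _)) uA|/(central_mx_unit hb (expi_neq0 _)) uA].
    + by rewrite -(mulKmx uA (comp 2 q)) AP mulmx0.
    + by rewrite -(mulmxK (_ : (A ty)^T \in unitmx) (comp 2 q)) ?unitmx_tr// PA mul0mx.
  split=> //; have := ev 2; rewrite comp0 sum_fluxes /= /jumps P0 !mulmx0 !mul0mx.
  by rewrite !scaler0 !addr0 scaler0 addr0.
- apply/eqP; apply: comp_inj => c; rewrite evol_comp comp0 sum_fluxes.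
  rewrite /jumps {1}/xflux {1}/yflux P0 !mulmx0 !mul0mx !scaler0 !addr0 scaler0 addr0 UV.
  by elim/ord3_ind: c.
Qed.

End FixedCell.
End Kernel.

(** The two cancellation laws make [f] an isomorphism onto [S]: one gives injectivity, the other
    shows that the image is all of [S]. *)
Lemma dim_param (F : fieldType) (E W : vectType F) (S : {vspace W}) (f : E -> W) (g : W -> E) :
  linear f -> (forall x, f x \in S) -> cancel f g -> {in S, cancel g f} ->
  \dim S = dim E.
Proof.
move=> lf fS fK gK.
pose f' : {linear E -> W} := HB.pack f (GRing.isLinear.Build _ _ _ _ f lf).
have -> : S = limg (linfun f').
  apply/vspaceP => w; apply/idP/idP => [wS|/memv_imgP[x _ ->]]; last by rewrite lfunE fS.
  by rewrite -(gK w wS) -[f _](lfunE f'); exact: memv_img (memvf _).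
rewrite limg_dim_eq ?dimvf// (_ : lker _ = 0%VS) ?capv0//.
apply/eqP/lker0P => x y; rewrite !lfunE => /(congr1 g).
by rewrite !fK.
Qed.

(** * Solving the balance equation for either velocity component *)

Section BalanceEquation.
Variables (F : fieldType) (n : nat) (A B : 'M[F]_n) (x y : F).
Hypotheses (x0 : x != 0) (y0 : y != 0).
Implicit Types U V : 'M[F]_n.

Lemma balance_solve_l U V : A \in unitmx ->
  x^-1 *: (A *m U) + y^-1 *: (V *m B) = 0 <-> U = - (x / y) *: (invmx A *m V *m B).
Proof.
move=> uA; split=> [/eqP|->]; last first.
  rewrite -scalemxAr -!mulmxA mulKVmx// scalerA -scalerDl mulrN mulrA mulVf//.
  by rewrite mul1r addNr scale0r.
rewrite addr_eq0 => /eqP /(congr1 (fun M => x *: (invmx A *m M))).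
rewrite -scalemxAr mulKmx// scalerA mulfV// scale1r => ->.
by rewrite mulmxN -scalemxAr scalerN scalerA scaleNr -mulmxA.
Qed.

Lemma balance_solve_r U V : B \in unitmx ->
  x^-1 *: (A *m U) + y^-1 *: (V *m B) = 0 <-> V = - (y / x) *: (A *m U *m invmx B).
Proof.
move=> uB; split=> [/eqP|->]; last first.
  rewrite -scalemxAl mulmxKV// scalerA -scalerDl mulrN mulrA mulVf//.
  by rewrite mul1r addrN scale0r.
rewrite addrC addr_eq0 => /eqP /(congr1 (fun M => y *: (M *m invmx B))).
rewrite -scalemxAl mulmxK// scalerA mulfV// scale1r => ->.
by rewrite mulNmx -scalemxAl scalerN scalerA scaleNr.
Qed.

Lemma scale_conj_linear (M N : 'M[F]_n) (a : F) : linear (fun V => a *: (M *m V *m N)).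
Proof.
move=> c U V; rewrite mulmxDr mulmxDl scalerDr; congr (_ + _).
by rewrite -scalemxAr -scalemxAl !scalerA mulrC.
Qed.

(** This outer product explains the shape of the kernel vectors: a single unit v-entry produces
    u-entries that factor into a function of [tx] and a function of [ty]. *)
Lemma conj_delta_mx (M N : 'M[F]_n) k l i j :
  (M *m delta_mx k l *m N^T) i j = M i k * N j l.
Proof.
rewrite mxE (bigD1 l)//= big1 ?addr0 => [|e el].
  rewrite [_^T l j]mxE mxE (bigD1 k)//= big1 ?addr0 => [|e ek].
    by rewrite !mxE !eqxx mulr1.
  by rewrite !mxE (negPf ek) mulr0.
rewrite mxE big1 ?mul0r// => e' _.
by rewrite !mxE (negPf el) andbF mulr0.
Qed.

End BalanceEquation.

(** * Dimension of the kernel and a criterion for spanning it *)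

Section SteadySpace.
Variables (R : realType) (b : nat -> {poly R}).
Hypothesis hb : orthonormal_basis b.
Local Notation C := R[i].
Variables (K : nat) (dx dy kx ky : R).
Hypotheses (dx0 : 0 < dx) (dy0 : 0 < dy).
Let tx := expi (kx * dx).
Let ty := expi (ky * dy).
Local Notation A t := (central_mx b K t).
Local Notation steadyD := (steady b K (Dp R) (Dp R) dx dy kx ky).

Let dxn : dx%:C != 0 :> C. Proof. by rewrite (inj_eq (@complexI _)) gt_eqF. Qed.
Let dyn : dy%:C != 0 :> C. Proof. by rewrite (inj_eq (@complexI _)) gt_eqF. Qed.

Lemma steady_Dp_eq0 : regular_mode K tx \/ regular_mode K ty ->
  steadyD = steady b K 0 0 dx dy kx ky.
Proof.
move=> reg; apply/vspaceP => q.
have := mem_steady hb 1 dx0 dy0 reg q; have := mem_steady hb 0 dx0 dy0 reg q.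
rewrite (scale1r (Dp R)) (scale0r (Dp R)) => h0 h1.
by apply/idP/idP => [/h1/h0|/h0/h1].
Qed.

Lemma mem_steadyD (q : 'cV[C]_(ndof K)) : regular_mode K tx \/ regular_mode K ty ->
  q \in steadyD <-> comp 2 q = 0 /\
  (dx%:C)^-1 *: (A tx *m comp 0 q) + (dy%:C)^-1 *: (comp 1 q *m (A ty)^T) = 0.
Proof. by move=> reg; have := mem_steady hb 1 dx0 dy0 reg q; rewrite (scale1r (Dp R)). Qed.

Lemma steady_comp0 (q : 'cV[C]_(ndof K)) : regular_mode K tx -> q \in steadyD ->
  comp 0 q = - (dx%:C / dy%:C) *: (invmx (A tx) *m comp 1 q *m (A ty)^T).
Proof.
move=> reg /(mem_steadyD _ (or_introl reg))[_ E].
exact: (balance_solve_l _ _ dxn _ _ (central_mx_unit hb (expi_neq0 _) reg)).1 E.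
Qed.

Lemma of_comps_linear0 (f : 'M[C]_K.+1 -> 'M[C]_K.+1) : linear f ->
  linear (fun V => of_comps (f V) V 0).
Proof.
move=> lf a U V; apply: comp_inj => c; rewrite compD compZ !comp_of_comps.
by elim/ord3_ind: c => /=; rewrite ?lf// scaler0 addr0.
Qed.

Lemma of_comps_linear1 (f : 'M[C]_K.+1 -> 'M[C]_K.+1) : linear f ->
  linear (fun U => of_comps U (f U) 0).
Proof.
move=> lf a U V; apply: comp_inj => c; rewrite compD compZ !comp_of_comps.
by elim/ord3_ind: c => /=; rewrite ?lf// scaler0 addr0.
Qed.

Lemma dim_steady : regular_mode K tx \/ regular_mode K ty ->
  \dim steadyD = (K.+1 ^ 2)%N.
Proof.
move=> reg; have -> : (K.+1 ^ 2)%N = dim 'M[C]_K.+1 by rewrite dim_matrix -mulnn.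
case: (reg) => r; have uA := central_mx_unit hb (expi_neq0 _) r.
- have lf := of_comps_linear0 (scale_conj_linear (invmx (A tx)) (A ty)^T (- (dx%:C / dy%:C))).
  apply: (dim_param (g := comp 1) lf) => [V|V|q qS].
  + apply/(mem_steadyD _ reg); rewrite !comp_of_comps /=; split=> //.
    exact/(balance_solve_l _ _ dxn _ _ uA).
  + by rewrite comp_of_comps.
  + apply: comp_inj => c; rewrite comp_of_comps.
    elim/ord3_ind: c => //=; first by rewrite (steady_comp0 r qS).
    by have [-> _] := (mem_steadyD _ reg).1 qS.
- have uA' : (A ty)^T \in unitmx by rewrite unitmx_tr.
  have lf := of_comps_linear1 (scale_conj_linear (A tx) (invmx (A ty)^T) (- (dy%:C / dx%:C))).
  apply: (dim_param (g := comp 0) lf) => [U|U|q qS].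
  + apply/(mem_steadyD _ reg); rewrite !comp_of_comps /=; split=> //.
    exact/(balance_solve_r _ _ dyn _ _ uA').
  + by rewrite comp_of_comps.
  + apply: comp_inj => c; rewrite comp_of_comps.
    have [P0 /(balance_solve_r _ _ dyn _ _ uA') E] := (mem_steadyD _ reg).1 qS.
    by elim/ord3_ind: c => //=; rewrite E.
Qed.

Lemma steady_comp1_eq0 (q : 'cV[C]_(ndof K)) : regular_mode K tx ->
  q \in steadyD -> comp 1 q = 0 -> q = 0.
Proof.
move=> reg qS V0; apply: comp_inj => c; rewrite comp0.
have U0 := steady_comp0 reg qS; rewrite V0 mulmx0 mul0mx scaler0 in U0.
by have [P0 _] := (mem_steadyD _ (or_introl reg)).1 qS; elim/ord3_ind: c.
Qed.

Lemma comp_kvec c k l us : comp c (kvec dx dy K k l us) =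
  nth 0 [:: \matrix_(i, j) ((dx / dy)%:C * nth 0 us (i * K.+1 + j)%N);
            \matrix_(i, j) ((i == k :> nat) && (j == l :> nat))%:R; 0] c.
Proof.
apply/matrixP => i j; rewrite !mxE field_of_dof xmode_dof ymode_dof.
by elim/ord3_ind: c; rewrite /= !mxE.
Qed.

Lemma kvec_steady (k l : 'I_K.+1) us (B : 'M[C]_K.+1) : regular_mode K tx ->
  A tx *m B = 1%:M ->
  (forall i j : 'I_K.+1, nth 0 us (i * K.+1 + j) = - (B i k * A ty j l)) ->
  kvec dx dy K k l us \in steadyD.
Proof.
move=> reg AB usE; apply/(mem_steadyD _ (or_introl reg)); rewrite !comp_kvec /=.
split=> //.
have -> : \matrix_(i, j) ((i == k :> nat) && (j == l :> nat))%:R = delta_mx k l :> 'M[C]_K.+1.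
  by apply/matrixP => i j; rewrite !mxE.
have uA := central_mx_unit hb (expi_neq0 _) reg.
apply/(balance_solve_l _ _ dxn _ _ uA).
have -> : invmx (A tx) = B by rewrite -[LHS]mulmx1 -AB mulKmx.
apply/matrixP => i j; rewrite [LHS]mxE usE mx_entryZ conj_delta_mx.
by rewrite mulrN mulNr rmorphM fmorphV.
Qed.

(** A kernel element is determined by its v coefficients, so it suffices that some combination of
    [ws] reproduces these; [c] supplies its coefficients. *)
Lemma steady_span (ws : seq 'cV[C]_(ndof K)) (c : 'cV[C]_(ndof K) -> seq C) :
  regular_mode K tx -> (forall w, w \in ws -> w \in steadyD) ->
  (forall q, comp 1 (\sum_(i < size ws) (c q)`_i *: ws`_i) = comp 1 q) ->
  steadyD = <<ws>>%VS.
Proof.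
move=> reg wS cE; apply/eqP; rewrite eqEsubv; apply/andP; split; last exact/span_subvP.
apply/subvP => q qS; have -> : q = \sum_(i < size ws) (c q)`_i *: ws`_i.
  apply/eqP; rewrite -subr_eq0; apply/eqP/(steady_comp1_eq0 reg).
    by rewrite rpredB// rpred_sum// => i _; rewrite rpredZ// wS// mem_nth.
  by rewrite compB cE subrr.
by rewrite rpred_sum// => i _; rewrite rpredZ// memv_span// mem_nth.
Qed.

End SteadySpace.

(** * Explicit inverses and kernel vectors for K = 1 and K = 2 *)

Section ExplicitKernels.
Variables (R : realType) (b : nat -> {poly R}).
Hypothesis hb : orthonormal_basis b.
Local Notation C := R[i].
Local Notation sq x := ((Num.sqrt x)%:C : C).

Definition tau_of (t : C) : C := (t ^+ 2 - 1) / (4 * t).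
Definition r_of (t : C) : C := (t - 1) ^+ 2 / (4 * t).
Definition s_of (t : C) : C := (1 + t) ^+ 2 / (4 * t).
Definition X_of (t : C) : C := (1 + t) / (t - 1).

Definition mx_of_rows n (rows : seq (seq C)) : 'M[C]_n :=
  \matrix_(i, j) nth 0 (nth [::] rows i) j.

(** The entries do not depend on the degree, so the upper left block serves K = 1. *)
Definition central_rows (t : C) : seq (seq C) :=
  let u := tau_of t in let r := r_of t in let s := s_of t in
  [:: [:: 2 * u; - (2 * sq 3 * r); 2 * sq 5 * u];
      [:: 2 * sq 3 * r; - (6 * u); 2 * sq 3 * sq 5 * s];
      [:: 2 * sq 5 * u; - (2 * sq 3 * sq 5 * s); 10 * u]].

Definition central_inv1 (t : C) : 'M[C]_2 := mx_of_rows 2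
  [:: [:: X_of t / 2; - (2 * sq 3)^-1]; [:: (2 * sq 3)^-1; - (X_of t / 6)]].

(** Only entry (0, 0) has the pole X at t = 1, whereas for K = 1 both diagonal entries do. The last
    entry has a pole at t = -1, the checkerboard mode. *)
Definition central_inv2 (t : C) : 'M[C]_3 := mx_of_rows 3
  [:: [:: X_of t / 2; - (2 * sq 3)^-1; 0];
      [:: (2 * sq 3)^-1; 0; - (2 * sq 3 * sq 5)^-1];
      [:: 0; (2 * sq 3 * sq 5)^-1; - (10 * X_of t)^-1]].

Lemma sqC_sqr (n : nat) : sq n%:R ^+ 2 = n%:R.
Proof. by rewrite -rmorphXn/= sqr_sqrtr ?ler0n// rmorph_nat. Qed.

Lemma sqC_neq0 (n : nat) : sq n.+1%:R != 0.
Proof. by rewrite -sqrf_eq0 sqC_sqr pnatr_eq0. Qed.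

Lemma chiE k : chi b k = sq (k.*2.+1)%:R.
Proof. by rewrite /chi (bhiE hb). Qed.

Lemma central_mx_bhi K (t : C) k a : central_mx b K t k a = chi b k * chi b a *
  (- (if (a < k)%N then 1 - (-1) ^+ (k + a) else 0) +
   (t - (-1) ^+ k) / t * ((1 + t * (-1) ^+ a) / 2)).
Proof.
rewrite central_mxE (stiffE_bhi hb) !(clo_parity hb).
have -> : (if (a < k)%N then bhi b k * bhi b a * (1 - (-1) ^+ (k + a)) else 0)%:C =
  chi b k * chi b a * (if (a < k)%N then 1 - (-1) ^+ (k + a) else 0).
  case: ifP => _; last by rewrite mulr0.
  by rewrite !rmorphM rmorphB rmorph1 rmorphXn rmorphN1.
move: ((-1) ^+ k) ((-1) ^+ a) (if _ then _ else _) (chi _ _) (chi _ _).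
by move=> *; rewrite mulrDr mulrN; congr (_ + _); ring.
Qed.

Lemma central_mx_rows K (t : C) (k a : 'I_K.+1) : t != 0 -> (K <= 2)%N ->
  central_mx b K t k a = nth 0 (nth [::] (central_rows t) k) a.
Proof.
move=> t0 K2; rewrite central_mx_bhi !chiE.
have h3 := sqC_sqr 3; have h5 := sqC_sqr 5.
have sq1 : sq 1 = 1 by rewrite sqrtr1.
have : (k < 3)%N by exact: (@leq_trans K.+1).
have : (a < 3)%N by exact: (@leq_trans K.+1).
move: (k : nat) (a : nat) => [|[|[|//]]] [|[|[|//]]] _ _;
  rewrite /central_rows /= /tau_of /r_of /s_of ?sq1 /=; move: h3 h5;
  move: (sq 3) (sq 5) => x y hx hy; field: hx hy; exact: t0.
Qed.

Lemma mul_central_inv1 (t : C) : t != 0 -> t != 1 -> central_mx b 1 t *m central_inv1 t = 1%:M.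
Proof.
move=> t0 t1; have t1' : t - 1 != 0 by rewrite subr_eq0.
have h3 := sqC_sqr 3; have n3 := sqC_neq0 2.
apply/matrixP => i j; rewrite [RHS]mxE -val_eqE mxE !big_ord_recl big_ord0 !central_mx_rows// !mxE.
move: h3 n3; rewrite /central_rows /tau_of /r_of /s_of /X_of; move: (sq 3) => x hx x0.
by case: i j => [[|[|//]] ?] [[|[|//]] ?] /=; field: hx; rewrite ?x0 ?t1' ?t0.
Qed.

Lemma mul_central_inv2 (t : C) : t != 0 -> t != 1 -> t != -1 ->
  central_mx b 2 t *m central_inv2 t = 1%:M.
Proof.
move=> t0 t1 t2; have t1' : t - 1 != 0 by rewrite subr_eq0.
have t2' : 1 + t != 0 by rewrite addrC addr_eq0.
have h3 := sqC_sqr 3; have n3 := sqC_neq0 2.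
have h5 := sqC_sqr 5; have n5 := sqC_neq0 4.
apply/matrixP => i j; rewrite [RHS]mxE -val_eqE mxE !big_ord_recl big_ord0 !central_mx_rows// !mxE.
move: h3 n3 h5 n5; rewrite /central_rows /tau_of /r_of /s_of /X_of.
move: (sq 3) (sq 5) => x y hx x0 hy y0.
by case: i j => [[|[|[|//]]] ?] [[|[|[|//]]] ?] /=; field: hx hy;
  rewrite ?x0 ?y0 ?t1' ?t2' ?t0.
Qed.

Lemma sqC_div (m n : nat) : sq (m%:R / n%:R) = sq m%:R / sq n%:R.
Proof. by rewrite sqrtrM ?ler0n// sqrtrV ?ler0n// rmorphM fmorphV. Qed.

Lemma sqC_mul (m n : nat) : sq (m * n)%:R = sq m%:R * sq n%:R.
Proof. by rewrite natrM sqrtrM ?ler0n// rmorphM. Qed.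

Lemma steady_w1 (dx dy kx ky : R) : 0 < dx -> 0 < dy ->
  regular_mode 1 (expi (kx * dx)) ->
  steady b 1 (Dp R) (Dp R) dx dy kx ky = <<w1 dx dy kx ky>>%VS.
Proof.
move=> dx0 dy0 reg; have /andP[t1 _] := reg.
have AB := mul_central_inv1 (expi_neq0 _) t1.
pose V (q : 'cV[C]_(ndof 1)) (k l : 'I_2) := comp 1 q k l.
have wS w : w \in w1 dx dy kx ky -> w \in steady b 1 (Dp R) (Dp R) dx dy kx ky.
{ have ty0 := expi_neq0 (ky * dy).
  have h3 := sqC_sqr 3; have n3 := sqC_neq0 2.
  have entries (k l : 'I_2) us : (forall i j : 'I_2, nth 0 us (i * 2 + j) =
      - (central_inv1 (expi (kx * dx)) i k * nth 0 (nth [::] (central_rows (expi (ky * dy))) j) l)) ->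
      kvec dx dy 1 k l us \in steady b 1 (Dp R) (Dp R) dx dy kx ky.
    move=> h; apply: (kvec_steady hb dx0 dy0 reg AB) => i j.
    by rewrite central_mx_rows.
  move: w; apply/allP; rewrite /w1 /=.
  rewrite -/(X_of _) -/(tau_of _) -/(r_of _).
  rewrite (entries 1 1) ?(entries 1 0) ?(entries 0 1) ?(entries 0 0)//.
  all: move=> i j; rewrite mxE /central_rows; move: h3 n3.
  (* Each u-entry is one factor in [tx] times one in [ty], so the identities hold with X, tau, r and
     s as independent atoms. *)
  all: move: (X_of _) (tau_of _) (r_of _) (s_of _) => X u r s; move: (sq 3) => x hx x0.
  all: case: i => [[|[|//]] ?]; case: j => [[|[|//]] ?] /=; field: hx; rewrite ?x0//.
}
apply: (steady_span (c := fun q => [:: V q 1 1; V q 1 0; V q 0 1; V q 0 0]) hb dx0 dy0 reg) => //.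
move=> q; apply/matrixP => i j; rewrite !big_ord_recl big_ord0 /w1 /=.
  rewrite !compD !compZ !comp_kvec !comp0 /= !(mx_entryD, mx_entryZ) !mxE /V.
  case: i => [[|[|//]] ?]; case: j => [[|[|//]] ?] /=; rewrite ?(mulr0, mulr1, addr0, add0r).
  all: by rewrite !mxE; congr (q (dof _ _ _) _); exact: val_inj.
Qed.

Lemma steady_w2 (dx dy kx ky : R) : 0 < dx -> 0 < dy ->
  regular_mode 2 (expi (kx * dx)) ->
  steady b 2 (Dp R) (Dp R) dx dy kx ky = <<w2 dx dy kx ky>>%VS.
Proof.
move=> dx0 dy0 reg; have /andP[t1 /= t2] := reg.
have AB := mul_central_inv2 (expi_neq0 _) t1 t2.
pose V (q : 'cV[C]_(ndof 2)) (k l : 'I_3) := comp 1 q k l.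
have wS w : w \in w2 dx dy kx ky -> w \in steady b 2 (Dp R) (Dp R) dx dy kx ky.
{ have ty0 := expi_neq0 (ky * dy).
  have X0 : X_of (expi (kx * dx)) != 0.
    by rewrite mulf_neq0// ?invr_eq0 ?subr_eq0// addrC addr_eq0.
  have h3 := sqC_sqr 3; have n3 := sqC_neq0 2.
  have h5 := sqC_sqr 5; have n5 := sqC_neq0 4.
  have entries (k l : 'I_3) us : (forall i j : 'I_3, nth 0 us (i * 3 + j) =
      - (central_inv2 (expi (kx * dx)) i k * nth 0 (nth [::] (central_rows (expi (ky * dy))) j) l)) ->
      kvec dx dy 2 k l us \in steady b 2 (Dp R) (Dp R) dx dy kx ky.
    move=> h; apply: (kvec_steady hb dx0 dy0 reg AB) => i j.
    by rewrite central_mx_rows.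
  move: w; apply/allP; rewrite /w2 /=.
  rewrite -/(X_of _) -/(tau_of _) -/(r_of _) -/(s_of _).
  rewrite (sqC_div 5 3) (sqC_div 3 5) (sqC_mul 3 5).
  rewrite (entries 2 2) ?(entries 2 1) ?(entries 2 0) ?(entries 1 2) ?(entries 1 1)
    ?(entries 1 0) ?(entries 0 2) ?(entries 0 1) ?(entries 0 0)//.
  all: move=> i j; rewrite mxE /central_rows; move: X0 h3 n3 h5 n5.
  all: move: (X_of _) (tau_of _) (r_of _) (s_of _) => X u r s X0.
  all: move: (sq 3) (sq 5) => x y hx x0 hy y0.
  all: case: i => [[|[|[|//]]] ?]; case: j => [[|[|[|//]]] ?] /=; field: hx hy;
    rewrite ?x0 ?y0 ?X0//.
}
apply: (steady_span (c := fun q => [:: V q 2 2; V q 2 1; V q 2 0; V q 1 2; V q 1 1;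
  V q 1 0; V q 0 2; V q 0 1; V q 0 0]) hb dx0 dy0 reg) => //.
move=> q; apply/matrixP => i j; rewrite !big_ord_recl big_ord0 /w2 /=.
  rewrite !compD !compZ !comp_kvec !comp0 /= !(mx_entryD, mx_entryZ) !mxE /V.
  case: i => [[|[|[|//]]] ?]; case: j => [[|[|[|//]]] ?] /=; rewrite ?(mulr0, mulr1, addr0, add0r).
  all: by rewrite !mxE; congr (q (dof _ _ _) _); exact: val_inj.
Qed.

End ExplicitKernels.

(** * Calculus of order bounds as the cell size tends to 0 *)

Section Asymptotics.
Local Open Scope classical_set_scope.
Variable R : realType.
Local Notation C := R[i].
Implicit Types (e f : R -> C) (g : R -> R).

(* [scal_bigO e p] is [bigO (fun h => h `^ p) e]; products need other gauges. *)
Definition bigO g e := exists c : R, \forall h \near (0 : R)^'+, `|e h| <= (c * g h)%:C.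

Local Notation near0 P := (\forall h \near (0 : R)^'+, P h).

Lemma near0_gt0 : near0 (fun h => 0 < h).
Proof. exact: nbhs_right_gt. Qed.

Lemma near0_lt (x : R) : 0 < x -> near0 (fun h => h < x).
Proof. exact: nbhs_right_lt. Qed.

Lemma eq_bigO g e f : near0 (fun h => e h = f h) -> bigO g e -> bigO g f.
Proof. by move=> ef [c He]; exists c; apply: filterS2 ef He => h ->. Qed.

Lemma bigO0 g : bigO g (fun=> 0).
Proof. by exists 0; apply: nearW => h; rewrite mul0r normr0. Qed.

Lemma bigOD g e f : bigO g e -> bigO g f -> bigO g (fun h => e h + f h).
Proof.
move=> [c He] [d Hf]; exists (c + d); apply: filterS2 He Hf => h He Hf.
by rewrite mulrDl rmorphD; apply: le_trans (ler_normD _ _) (lerD He Hf).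
Qed.

Lemma bigON g e : bigO g e -> bigO g (fun h => - e h).
Proof. by move=> [c He]; exists c; apply: filterS He => h; rewrite normrN. Qed.

Lemma bigOB g e f : bigO g e -> bigO g f -> bigO g (fun h => e h - f h).
Proof. by move=> He Hf; apply: bigOD => //; exact: bigON. Qed.

Lemma bigO_sum g n (F : 'I_n -> R -> C) : (forall i, bigO g (F i)) ->
  bigO g (fun h => \sum_i F i h).
Proof.
elim: n F => [F _|n IH F HF].
  by apply: eq_bigO (bigO0 g); apply: nearW => h; rewrite big_ord0.
have := bigOD (IH _ (fun i => HF (widen_ord (leqnSn n) i))) (HF ord_max).
by apply: eq_bigO; apply: nearW => h; rewrite big_ord_recr.
Qed.

Lemma bigOM g g' e f : bigO g e -> bigO g' f ->
  bigO (fun h => g h * g' h) (fun h => e h * f h).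
Proof.
move=> [c He] [d Hf]; exists (c * d); apply: filterS2 He Hf => h He Hf.
by rewrite normrM mulrACA rmorphM ler_pM.
Qed.

Definition bigOn n e := bigO (fun h => h ^+ n) e.

Lemma bigOnM n m e f : bigOn n e -> bigOn m f -> bigOn (n + m) (fun h => e h * f h).
Proof.
move=> He Hf; have := bigOM He Hf; rewrite /bigOn; congr bigO.
by apply/funext => h; rewrite exprD.
Qed.

Lemma bigOn_cst (z : C) : bigOn 0 (fun=> z).
Proof.
exists (complex.Re `|z|); apply: nearW => h; rewrite expr0 mulr1.
by rewrite normc_def.
Qed.

Lemma bigO_cM g (z : C) e : bigO g e -> bigO g (fun h => z * e h).
Proof.
move=> He; have := bigOM (bigOn_cst z) He; rewrite /bigOn; congr bigO.
by apply/funext => h; rewrite mul1r.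
Qed.

Lemma bigO_Mc g (z : C) e : bigO g e -> bigO g (fun h => e h * z).
Proof.
move/(bigO_cM z); apply: eq_bigO; apply: nearW => h; exact: mulrC.
Qed.

Lemma bigOn_X n : bigOn n (fun h => h%:C ^+ n).
Proof.
exists 1; apply: filterS near0_gt0 => h h0.
by rewrite mul1r -rmorphXn normcR ger0_norm// exprn_ge0// ltW.
Qed.

Lemma bigOn_h : bigOn 1 (fun h => h%:C).
Proof. exact: bigOn_X 1. Qed.

Lemma bigOn_weak n m e : (m <= n)%N -> bigOn n e -> bigOn m e.
Proof.
move=> mn [c He]; exists `|c|.
apply: filterS3 He near0_gt0 (near0_lt ltr01) => h He h0 h1.
apply: le_trans He _; rewrite lecR (le_trans (ler_norm _))// normrM ler_wpM2l//.
by rewrite ger0_norm ?exprn_ge0 ?(ltW h0)// ler_wiXn2l// ltW.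
Qed.

Lemma scal_bigO_nat e n : bigOn n e <-> scal_bigO e n%:R.
Proof.
split=> -[c He]; exists c; apply: filterS2 He near0_gt0 => h + h0.
  by rewrite powR_mulrn// ltW.
by rewrite powR_mulrn// ltW.
Qed.

Definition cabs (z : C) : R := complex.Re `|z|.

Lemma cabsE (z : C) : `|z| = (cabs z)%:C.
Proof. by rewrite /cabs normc_def. Qed.

Lemma le_cabs (z : C) (x : R) : (`|z| <= x%:C) = (cabs z <= x).
Proof. by rewrite cabsE lecR. Qed.

Lemma cabsM (z w : C) : cabs (z * w) = cabs z * cabs w.
Proof. by apply: (@complexI R); rewrite rmorphM -!cabsE normrM. Qed.

Lemma cabsV (z : C) : cabs z^-1 = (cabs z)^-1.
Proof. by apply: (@complexI R); rewrite fmorphV -!cabsE normfV. Qed.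

Lemma cabs_le_sub (z w : C) : cabs z <= cabs w + cabs (w - z).
Proof.
rewrite -lecR rmorphD -!cabsE -{1}[z](subKr w); exact: ler_normB.
Qed.

Lemma cabs_gt0 (z : C) : (0 < cabs z) = (z != 0).
Proof. by rewrite -ltcR -cabsE normr_gt0. Qed.

Lemma cabs_Xn (h : R) n : 0 < h -> cabs (h%:C ^+ n) = h ^+ n.
Proof.
move=> h0; apply: (@complexI R).
by rewrite -cabsE -rmorphXn normcR ger0_norm// exprn_ge0// ltW.
Qed.

Lemma leading_ge n (z : C) e : z != 0 -> bigOn n.+1 (fun h => e h - z * h%:C ^+ n) ->
  near0 (fun h => cabs z * h ^+ n <= 2 * cabs (e h)).
Proof.
rewrite -cabs_gt0 => z0 [c Hc].
(* Below |z| / (2 (1 + |c|)) the remainder is at most half of the leading term; the added 1 keeps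
   the quotient meaningful for c = 0. *)
have d0 : 0 < 2 * (1 + `|c|) by rewrite mulr_gt0// ltr_pwDl.
have r0 : 0 < cabs z / (2 * (1 + `|c|)) by rewrite divr_gt0.
apply: filterS3 Hc near0_gt0 (near0_lt r0) => h + h0; rewrite le_cabs => Hc hr.
have hn : 0 < h ^+ n by rewrite exprn_gt0.
have := cabs_le_sub (z * h%:C ^+ n) (e h); rewrite cabsM cabs_Xn// => H.
have ch : c * h <= cabs z / 2.
  rewrite ltr_pdivlMr// in hr; have := ler_wpM2r (ltW h0) (ler_norm c).
  have := normr_ge0 c; nra.
have : c * h ^+ n.+1 <= cabs z / 2 * h ^+ n by rewrite exprS mulrA ler_wpM2r// ltW.
lra.
Qed.

Lemma leading_neq0 n (z : C) e : z != 0 -> bigOn n.+1 (fun h => e h - z * h%:C ^+ n) ->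
  near0 (fun h => e h != 0).
Proof.
move=> z0 /(leading_ge z0) H; apply: filterS2 H near0_gt0 => h H h0.
rewrite -cabs_gt0; rewrite -cabs_gt0 in z0.
have : 0 < cabs z * h ^+ n by rewrite mulr_gt0// exprn_gt0.
lra.
Qed.

Lemma bigOn_inv n (z : C) e : z != 0 -> bigOn n.+1 (fun h => e h - z * h%:C ^+ n) ->
  bigOn 0 (fun h => h%:C ^+ n / e h).
Proof.
move=> z0 He; exists (2 / cabs z).
apply: filterS3 (leading_ge z0 He) (leading_neq0 z0 He) near0_gt0 => h H e0 h0.
rewrite -cabs_gt0 in z0; rewrite -cabs_gt0 in e0.
rewrite expr0 mulr1 le_cabs cabsM cabs_Xn// cabsV ler_pdivrMr//.
by rewrite mulrAC ler_pdivlMr// mulrC.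
Qed.

(** The last hypothesis says that [g] is o(h^n), in a form that also covers real exponents, whereas
    [e] has exact order h^n. *)
Lemma leading_contra n (z : C) e g : z != 0 -> bigOn n.+1 (fun h => e h - z * h%:C ^+ n) ->
  bigO g e -> (forall d : R, 0 < d -> near0 (fun h => `|g h| <= d * h ^+ n)) -> False.
Proof.
move=> z0 /(leading_ge z0) He [c Hc] Hg; rewrite -cabs_gt0 in z0.
have k0 : 0 < 4 * (1 + `|c|) by rewrite mulr_gt0// ltr_pwDl.
(* With this d the bounds combine to |z| h^n <= |z| h^n / 2. *)
pose d := cabs z / (4 * (1 + `|c|)).
have d0 : 0 < d by rewrite divr_gt0.
have : near0 (fun=> False).
  apply: filterS2 (filterI He Hc) (filterI (Hg _ d0) near0_gt0).
  move=> h [A]; rewrite le_cabs => B [D h0].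
  have hn : 0 < h ^+ n by rewrite exprn_gt0.
  have E : d * (4 * (1 + `|c|)) = cabs z by rewrite divfK// gt_eqF.
  have F : c * g h <= `|c| * (d * h ^+ n).
    by rewrite (le_trans (ler_norm _))// normrM ler_wpM2l.
  have c0 := normr_ge0 c; move: E F c0 A B z0 hn.
  move: (cabs z) (cabs (e h)) (h ^+ n) (`|c|) (c * g h) => w v x y u E F c0 A B z0 x0.
  have : w * x <= 2 * (y * (d * x)) by lra.
  rewrite -E; have : 0 < d * x by rewrite mulr_gt0.
  move: (d * x) => q q0; nra.
by move/filter_ex => [].
Qed.

(** A real exponent above n gains a factor h^(p - n) that tends to 0; the threshold d^(1 / (p - n))
    is where this factor equals d. *)
Lemma powR_small (p : R) (n : nat) : n%:R < p -> forall d : R, 0 < d ->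
  near0 (fun h => `|h * h `^ p| <= d * h ^+ n.+1).
Proof.
move=> np d d0; have a0 : 0 < p - n%:R by rewrite subr_gt0.
have x0 : 0 < d `^ ((p - n%:R)^-1) by rewrite powR_gt0.
apply: filterS2 near0_gt0 (near0_lt x0) => h h0 hx.
rewrite ger0_norm ?mulr_ge0 ?powR_ge0 ?(ltW h0)// exprS mulrCA ler_wpM2l ?(ltW h0)//.
have -> : p = (p - n%:R) + n%:R by rewrite subrK.
rewrite powRD; last by rewrite (gt_eqF h0) implybT.
rewrite powR_mulrn ?(ltW h0)// ler_wpM2r ?exprn_ge0 ?(ltW h0)//.
have := @ge0_ler_powR R (p - n%:R) (ltW a0) h (d `^ (p - n%:R)^-1).
rewrite !nnegrE => /(_ (ltW h0) (ltW x0) (ltW hx)).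
by rewrite -powRrM mulVf ?gt_eqF// powRr1// ltW.
Qed.

End Asymptotics.

(** * Taylor expansion of the plane wave *)

Section ExpiTaylor.
Variable R : realType.
Local Notation C := R[i].

Definition expi_jet n (x : C) : C := \sum_(j < n) ('i%C * x) ^+ j / (j`!)%:R.

Definition cos_jet n : {poly R} := \poly_(j < n) (complex.Re ('i%C ^+ j : C) / (j`!)%:R).
Definition sin_jet n : {poly R} := \poly_(j < n) (complex.Im ('i%C ^+ j : C) / (j`!)%:R).

Lemma expi_jetE n (x : R) : expi_jet n x%:C = (cos_jet n).[x] +i* (sin_jet n).[x].
Proof.
rewrite /expi_jet /cos_jet /sin_jet !horner_poly.
elim: n => [|n IH]; first by rewrite !big_ord0.
rewrite !big_ord_recr/= IH.
have -> : ('i%C * x%:C) ^+ n / n`!%:R =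
    (complex.Re ('i%C ^+ n : C) / n`!%:R * x ^+ n) +i*
    (complex.Im ('i%C ^+ n : C) / n`!%:R * x ^+ n).
  rewrite exprMn -rmorphXn.
  have -> : (n`!%:R : C)^-1 = (n`!%:R^-1)%:C by rewrite fmorphV rmorph_nat.
  case: ('i%C ^+ n) => u v /=; simpc.
  by congr (_ +i* _); rewrite ?(mulr0, subr0, addr0, add0r, mul0r) mulrAC.
by simpc.
Qed.

Lemma factS_inv (n : nat) : ((n.+1)`!%:R)^-1 *+ n.+1 = (n`!%:R)^-1 :> R.
Proof.
by rewrite factS natrM invfM -[LHS]mulr_natl mulrA divff ?mul1r// pnatr_eq0.
Qed.

Lemma deriv_cos_jet n : (cos_jet n.+1)^`() = - sin_jet n.
Proof.
apply/polyP => j; rewrite coef_deriv coefN !coef_poly ltnS.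
case: ifP => _; last by rewrite mul0rn oppr0.
rewrite -mulrnAr factS_inv -mulNr; congr (_ * _).
by rewrite exprSr ReiNIm.
Qed.

Lemma deriv_sin_jet n : (sin_jet n.+1)^`() = cos_jet n.
Proof.
apply/polyP => j; rewrite coef_deriv !coef_poly ltnS.
case: ifP => _; last by rewrite mul0rn.
by rewrite -mulrnAr factS_inv exprSr ImiRe.
Qed.

(** The mean value theorem in place of an integral remainder: it forgoes the factorial in the bound
    but raises the order by one. *)
Lemma derive_pow_le (f df : R -> R) n : f 0 = 0 -> (forall y : R, is_derive y 1 f (df y)) ->
  (forall y, `|df y| <= `|y| ^+ n) -> forall x, `|f x| <= `|x| ^+ n.+1.
Proof.
move=> f0 fd dfn x.
have fc : continuous f.
  by move=> y; apply/differentiable_continuous/derivable1_diffP; case: (fd y).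
have step y : `|y| <= `|x| -> `|df y * x| <= `|x| ^+ n.+1.
  move=> yx; rewrite normrM exprSr ler_wpM2r// (le_trans (dfn y))//.
  by rewrite lerXn2r// nnegrE.
have [x0|x0] := leP 0 x.
- have [c + E] := MVT_segment x0 (fun y _ => fd y) (continuous_subspaceT fc).
  rewrite in_itv/= => /andP[c0 cx]; move: E; rewrite f0 !subr0 => ->.
  by apply: step; rewrite !ger0_norm.
- have [c + E] := MVT_segment (ltW x0) (fun y _ => fd y) (continuous_subspaceT fc).
  rewrite in_itv/= => /andP[cx c0]; move: E; rewrite f0 !sub0r mulrN.
  by move/oppr_inj => ->; apply: step; rewrite !ler0_norm ?lerN2// ltW.
Qed.

(** Both remainders are treated in one induction, because differentiation exchanges them and lowers
    the order by one. *)
Lemma cos_sin_taylor n : (forall x, `|cos x - (cos_jet n).[x]| <= `|x| ^+ n) /\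
  (forall x, `|sin x - (sin_jet n).[x]| <= `|x| ^+ n).
Proof.
elim: n => [|n [IHc IHs]].
  rewrite /cos_jet /sin_jet; split=> x; rewrite poly_def big_ord0 horner0 subr0 expr0.
    exact: cos_max.
  exact: sin_max.
have c0 : (cos_jet n.+1).[0] = 1 by rewrite horner_coef0 coef_poly/= divr1.
have s0 : (sin_jet n.+1).[0] = 0 by rewrite horner_coef0 coef_poly/= mul0r.
split.
- apply: (@derive_pow_le (fun x => cos x - (cos_jet n.+1).[x])
    (fun x => - (sin x - (sin_jet n).[x]))) => [|y|y].
  + by rewrite cos0 c0 subrr.
  + by apply: is_derive_eq; rewrite deriv_cos_jet hornerN opprB opprK addrC.
  + by rewrite normrN.
- apply: (@derive_pow_le (fun x => sin x - (sin_jet n.+1).[x])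
    (fun x => cos x - (cos_jet n).[x])) => [|y|//].
  + by rewrite sin0 s0 subrr.
  + by apply: is_derive_eq; rewrite deriv_sin_jet.
Qed.

Lemma expi_taylor_le n (x : R) : `|expi x - expi_jet n x%:C| <= (2 * `|x| ^+ n)%:C.
Proof.
have [Hc Hs] := cos_sin_taylor n.
apply: le_trans (normc_le_ReIm _) _; rewrite expi_jetE lecR /=.
by rewrite mulr_natl mulr2n lerD.
Qed.

Lemma expi_taylor n (k : R) :
  bigOn n (fun h => expi (k * h) - expi_jet n (k%:C * h%:C)).
Proof.
exists (2 * `|k| ^+ n); apply: filterS (near0_gt0 R) => h h0.
rewrite -rmorphM; apply: le_trans (expi_taylor_le _ _) _.
by rewrite normrM exprMn (ger0_norm (ltW h0)) mulrA.
Qed.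

Lemma expiD (x y : R) : expi (x + y) = expi x * expi y.
Proof. by rewrite /expi cosD sinD; simpc; rewrite [sin x * _ + _]addrC. Qed.

Lemma expiN (x : R) : expi (- x) = (expi x)^-1.
Proof.
apply: (mulIf (expi_neq0 x)); rewrite mulVf ?expi_neq0// -expiD addNr.
by rewrite /expi cos0 sin0.
Qed.

Lemma norm_expi (x : R) : `|expi x| = 1.
Proof. by rewrite normc_def /= cos2Dsin2 sqrtr1. Qed.

Lemma bigOn_expi (k : R) : bigOn 0 (fun h => expi (k * h)).
Proof. by exists 1; apply: nearW => h; rewrite norm_expi expr0 mulr1. Qed.

Lemma bigOn_expiV (k : R) : bigOn 0 (fun h => (expi (k * h))^-1).
Proof.
by exists 1; apply: nearW => h; rewrite normfV norm_expi invr1 expr0 mulr1.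
Qed.

End ExpiTaylor.

(** * Moments of polynomials against a plane wave *)

Section Moments.
Variable R : realType.
Local Notation C := R[i].
Implicit Types (p q : {poly R}) (k h : R).

Definition cmom p k h : C := (h^-1)%:C *
  cint (- (h / 2)) (h / 2) (fun x => (p.[x / h])%:C * expi (k * x)).

Lemma continuous_scaled p h : continuous (fun x : R => p.[x / h]).
Proof.
move=> x; apply: (@continuous_comp _ _ _ (fun x : R => x / h) (horner p)).
  by apply: cvgM; [exact: cvg_id|exact: cvg_cst].
exact: continuous_horner.
Qed.

Lemma ccont_scaled p k h : ccont (fun x => (p.[x / h])%:C * expi (k * x)).
Proof.
by apply: ccontM (ccont_expi k); apply: ccont_real; exact: continuous_scaled.
Qed.

Lemma cmomD p q k h : cmom (p + q) k h = cmom p k h + cmom q k h.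
Proof.
rewrite /cmom -mulrDr -cintD; try exact: ccont_scaled.
congr (_ * cint _ _ _); apply/funext => x.
by rewrite hornerD rmorphD mulrDl.
Qed.

Lemma cmomZ (c : R) p k h : cmom (c *: p) k h = c%:C * cmom p k h.
Proof.
rewrite /cmom mulrCA -(cintZ _ _ c%:C); last exact: ccont_scaled.
congr (_ * cint _ _ _); apply/funext => x.
by rewrite hornerZ rmorphM mulrA.
Qed.

Lemma cmom_sum n (F : 'I_n -> {poly R}) k h :
  cmom (\sum_i F i) k h = \sum_i cmom (F i) k h.
Proof.
elim: n F => [|n IH] F; last by rewrite !big_ord_recr cmomD IH.
by rewrite !big_ord0 -(scale0r 0) cmomZ mul0r.
Qed.

Lemma half_gt h : 0 < h -> - (h / 2) < h / 2.
Proof.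
move=> h0; have h2 : 0 < h / 2 by rewrite divr_gt0.
lra.
Qed.

Lemma rint_scaled p h : 0 < h ->
  rint (- (h / 2)) (h / 2) (fun x => p.[x / h]) = h * pint p.
Proof.
move=> h0; have [q <-] := ex_antideriv p.
have -> : (fun x : R => (q^`()).[x / h]) = horner ((h *: (q \Po (h^-1 *: 'X)))^`()).
  apply/funext => x; rewrite derivZ deriv_comp derivZ derivX !hornerE horner_comp !hornerE/=.
  by rewrite mulr1 [h * _]mulrC mulfK ?gt_eqF// [h^-1 * x]mulrC.
rewrite rint_deriv ?half_gt// pint_deriv !hornerZ !horner_comp !hornerE/=.
have -> : h^-1 * h / 2 = 2^-1 by rewrite mulVf ?mul1r ?gt_eqF.
have -> : h^-1 * - (h / 2) = - 2^-1 by rewrite mulrN mulKf ?gt_eqF.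
by rewrite mulrBr.
Qed.

(** Integrate the derivative of [p.[x / h]] times the wave over the cell. The chain rule factor 1 /
    h supplies the normalisation of the first moment, and the second one therefore carries k h. *)
Lemma cmom_ibp p k h : 0 < h ->
  cmom p^`() k h + 'i%C * (k%:C * h%:C) * cmom p k h =
  (p.[2^-1])%:C * expi (k * (h / 2)) - (p.[- 2^-1])%:C / expi (k * (h / 2)).
Proof.
move=> h0; have hn : h%:C != 0 :> C by rewrite (inj_eq (@complexI _)) gt_eqF.
have -> : cmom p^`() k h = (h^-1)%:C *
    cint (- (h / 2)) (h / 2) (fun x => ((p^`()).[x / h])%:C * expi (k * x)) by [].
pose f x := ((p^`()).[x / h] / h)%:C * expi (k * x) +
  ('i%C * k%:C) * ((p.[x / h])%:C * expi (k * x)).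
have cf : ccont f.
  apply: ccontD; last by apply: ccontM (ccont_cst _) (ccont_scaled _ _ _).
  apply: ccontM (ccont_expi k); apply: ccont_real.
  apply: (@continuousM_fun _ (fun s : R => (p^`()).[s / h]) (fun=> h^-1)).
    exact: continuous_scaled.
  by move=> x; exact: cvg_cst.
pose F x : C := (p.[x / h])%:C * expi (k * x).
have dp (x : R) : is_derive x 1 (fun x : R => p.[x / h]) ((p^`()).[x / h] / h).
  have -> : (fun x : R => p.[x / h]) = horner (p \Po (h^-1 *: 'X)).
    by apply/funext => y; rewrite horner_comp !hornerE mulrC.
  apply: is_derive_eq; rewrite deriv_comp derivZ derivX !hornerE horner_comp !hornerE.
  by rewrite /= mulr1 [h^-1 * x]mulrC.
have dkx (x : R) : is_derive x 1 (fun x : R => k * x) k.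
  by apply: is_derive_eq; rewrite /GRing.scale/= mulr1.
have E : cint (- (h / 2)) (h / 2) f = F (h / 2) - F (- (h / 2)).
  apply: cint_FTC (half_gt h0) cf _ _ => x.
  - rewrite (_ : (fun s => _) = fun x : R => p.[x / h] * cos (k * x)); last first.
      by apply/funext => s; rewrite ReM /= mul0r subr0.
    apply: is_derive_eq.
    rewrite /f /expi /= /GRing.scale /=; ring.
  - rewrite (_ : (fun s => _) = fun x : R => p.[x / h] * sin (k * x)); last first.
      by apply/funext => s; rewrite ImM /= mul0r addr0.
    apply: is_derive_eq.
    rewrite /f /expi /= /GRing.scale /=; ring.
have := E; rewrite cintD; [| |exact: ccontM (ccont_cst _) (ccont_scaled _ _ _)]; last first.
  apply: ccontM (ccont_expi k); apply: ccont_real.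
  apply: (@continuousM_fun _ (fun s : R => (p^`()).[s / h]) (fun=> h^-1)).
    exact: continuous_scaled.
  by move=> x; exact: cvg_cst.
rewrite cintZ; last exact: ccont_scaled.
have -> : (fun x => ((p^`()).[x / h] / h)%:C * expi (k * x)) =
   (fun x => (h^-1)%:C * (((p^`()).[x / h])%:C * expi (k * x))).
  by apply/funext => x; rewrite mulrA -rmorphM [h^-1 * _]mulrC.
rewrite cintZ; last exact: ccont_scaled.
rewrite /F mulrN expiN mulNr -mulrA.
have -> : h / 2 / h = 2^-1 by rewrite mulrAC divff ?mul1r ?gt_eqF.
move=> <-; rewrite /cmom; congr (_ + _).
rewrite fmorphV; field; exact: hn.
Qed.

Lemma horner_bound p : exists2 M : R, 0 <= M & forall s, -1 <= s <= 1 -> `|p.[s]| <= M.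
Proof.
exists (\sum_(i < size p) `|p`_i|); first by apply: sumr_ge0.
move=> s s1; rewrite horner_coef (le_trans (ler_norm_sum _ _ _))//.
apply: ler_sum => i _; rewrite normrM -[leRHS]mulr1 ler_wpM2l// normrX exprn_ile1//.
by rewrite ler_norml.
Qed.

Definition cmom_jet n p (x : C) : C :=
  \sum_(j < n) ('i%C * x) ^+ j / (j`!)%:R * (pint (p * 'X^j))%:C.

Lemma cmom_taylor n p k :
  bigOn n (fun h => cmom p k h - cmom_jet n p (k%:C * h%:C)).
Proof.
have [M M0 pM] := horner_bound p.
(* M bounds the polynomial on the cell, 2 |k|^n comes from the Taylor remainder of the wave, and the
   outer 2 from [cint_le_sup]. *)
exists (2 * (M * (2 * `|k| ^+ n))); apply: filterS (near0_gt0 R) => h h0.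
have hn : h%:C != 0 :> C by rewrite (inj_eq (@complexI _)) gt_eqF.
pose e x : C := expi (k * x) - expi_jet n (k%:C * x%:C).
have cj : ccont (fun x : R => expi_jet n (k%:C * x%:C)).
  apply: ccont_sum => j; apply: ccontM (ccont_cst _).
  have -> : (fun x : R => ('i%C * (k%:C * x%:C)) ^+ j) =
     (fun x : R => ('i%C * k%:C) ^+ j * (x ^+ j)%:C).
    by apply/funext => x; rewrite mulrA exprMn rmorphXn.
  apply: ccontM (ccont_cst _) _; apply: ccont_real.
  have -> : (fun x : R => x ^+ j) = horner 'X^j by apply/funext => x; rewrite hornerXn.
  exact: continuous_horner.
have ce : ccont e.
  apply: ccontD (ccont_expi k) _.
  have -> : (fun x => - expi_jet n (k%:C * x%:C)) = (fun x : R => -1 * expi_jet n (k%:C * x%:C)).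
    by apply/funext => x; rewrite mulN1r.
  exact: ccontM (ccont_cst _) cj.
have cpr : ccont (fun x => (p.[x / h])%:C : C) by apply: ccont_real; exact: continuous_scaled.
have split_e : cint (- (h / 2)) (h / 2) (fun x => (p.[x / h])%:C * expi (k * x)) =
  cint (- (h / 2)) (h / 2) (fun x => (p.[x / h])%:C * expi_jet n (k%:C * x%:C)) +
  cint (- (h / 2)) (h / 2) (fun x => (p.[x / h])%:C * e x).
  rewrite -cintD; try exact: ccontM.
  by congr cint; apply/funext => x; rewrite -mulrDr /e addrC subrK.
have jetE : cint (- (h / 2)) (h / 2) (fun x => (p.[x / h])%:C * expi_jet n (k%:C * x%:C)) =
   h%:C * cmom_jet n p (k%:C * h%:C).
  have -> : (fun x => (p.[x / h])%:C * expi_jet n (k%:C * x%:C)) =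
    (fun x => \sum_(j < n) ('i%C * (k%:C * h%:C)) ^+ j / (j`!)%:R * (((p * 'X^j).[x / h])%:C : C)).
    apply/funext => x; rewrite mulr_sumr; apply: eq_bigr => j _.
    rewrite hornerM hornerXn.
    have -> : k%:C * x%:C = k%:C * h%:C * (x / h)%:C.
      have xE : h%:C * (x / h)%:C = x%:C :> C by rewrite -rmorphM mulrC divfK ?gt_eqF.
      by rewrite -mulrA xE.
    rewrite ['i%C * _]mulrA exprMn [(p.[x / h] * _)%:C]rmorphM rmorphXn /=; ring.
  rewrite cint_sum; last first.
    by move=> j; apply: ccontM (ccont_cst _) _; apply: ccont_real; exact: continuous_scaled.
  rewrite mulr_sumr; apply: eq_bigr => j _; rewrite cintZ; last first.
    by apply: ccont_real; exact: continuous_scaled.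
  by rewrite cint_real rint_scaled// rmorphM mulrCA.
rewrite /cmom split_e jetE mulrDr fmorphV mulKf// addrC addKr.
rewrite normrM normfV normcR (gtr0_norm h0) ler_pdivrMl ?ltcR//.
have hh : - (h / 2) <= h / 2 by rewrite ltW// half_gt.
apply: le_trans (cint_le_sup hh (ccontM cpr ce) (M := M * (2 * `|k| ^+ n * h ^+ n)) _) _; last first.
  rewrite -rmorphM lecR.
  have -> : h / 2 - - (h / 2) = h by rewrite opprK -splitr.
  by rewrite le_eqVlt; apply/orP; left; apply/eqP; ring.
move=> s /andP[s1 s2]; rewrite normrM rmorphM ler_pM//.
  rewrite normcR lecR; apply: pM.
  rewrite ler_pdivlMr// ler_pdivrMr//; apply/andP; split; lra.
rewrite /e -rmorphM; apply: le_trans (expi_taylor_le _ _) _; rewrite lecR.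
rewrite -mulrA ler_wpM2l// normrM exprMn ler_wpM2l ?exprn_ge0//.
rewrite lerXn2r ?nnegrE ?(ltW h0)// ler_norml; apply/andP; split; lra.
Qed.

End Moments.

(** * Phase factors for small cells *)

Section PhaseAsymptotics.
Variable R : realType.
Local Open Scope classical_set_scope.
Local Notation C := R[i].

Lemma bigOn_divh n (f : R -> C) : bigOn n.+1 f -> bigOn n (fun h => f h / h%:C).
Proof.
move=> [c Hc]; exists c; apply: filterS2 Hc (near0_gt0 R) => h + h0.
rewrite !le_cabs cabsM cabsV -[h%:C]expr1 cabs_Xn// expr1 ler_pdivrMr//.
by rewrite -mulrA -exprSr.
Qed.

Lemma expi_m1 (k : R) : bigOn 2 (fun h => expi (k * h) - 1 - 'i%C * k%:C * h%:C ^+ 1).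
Proof.
apply: eq_bigO (expi_taylor 2 k); apply: nearW => h.
by rewrite /expi_jet !big_ord_recr big_ord0 /= expr0 !expr1 !divr1 add0r opprD addrA mulrA.
Qed.

Lemma expi_m1_bigO (k : R) : bigOn 1 (fun h => expi (k * h) - 1).
Proof.
apply: eq_bigO (expi_taylor 1 k); apply: nearW => h.
by rewrite /expi_jet !big_ord_recr big_ord0 /= expr0 !divr1 add0r.
Qed.

Lemma expiV_m1_bigO (k : R) : bigOn 1 (fun h => 1 - (expi (k * h))^-1).
Proof.
apply: eq_bigO (bigOnM (expi_m1_bigO k) (bigOn_expiV k)); apply: nearW => h.
by rewrite mulrBl mulfV ?expi_neq0// mul1r.
Qed.

(** For small h the phase is close to 1, hence away from -1, while its leading deviation i k h keeps
    it away from 1. *)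
Lemma near_regular K (k : R) : k != 0 ->
  \forall h \near (0 : R)^'+, regular_mode K (expi (k * h)).
Proof.
move=> k0.
have ik0 : 'i%C * k%:C != 0 :> C.
  by rewrite -normr_gt0 normrM norm_i mul1r normr_gt0 (inj_eq (@complexI _)).
have H1 : bigOn 1 (fun h => expi (k * h) + 1 - 2%:R * h%:C ^+ 0).
  apply: eq_bigO (expi_m1_bigO k); apply: nearW => h.
  by rewrite expr0 mulr1 mulr2n opprD addrA addrK.
have n2 : 2%:R != 0 :> C by rewrite pnatr_eq0.
apply: filterS2 (leading_neq0 ik0 (expi_m1 k)) (leading_neq0 n2 H1) => h a b.
by rewrite /regular_mode -subr_eq0 a -addr_eq0 b orbT.
Qed.

End PhaseAsymptotics.

(** * Consistency error of the projected plane wave *)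

Section Consistency.
Variables (R : realType) (b : nat -> {poly R}).
Hypothesis hb : orthonormal_basis b.
Local Open Scope classical_set_scope.
Local Notation C := R[i].
Local Notation mom a := (cmom (b a)).
Local Notation lc k := ((b k)`_k).

Lemma DOF_comp K (kx ky h : R) c (k l : 'I_K.+1) : 0 < h ->
  DOF b K h h kx ky (dof c k l) 0 = Qhat kx ky c 0 * (mom k kx h * mom l ky h).
Proof.
move=> h0; rewrite mxE field_of_dof xmode_dof ymode_dof -mulrA; congr (_ * _).
have -> : (fun x => cint (- (h / 2)) (h / 2) (fun y =>
    ((b k).[x / h] * (b l).[y / h])%:C * expi (kx * x) * expi (ky * y))) =
  (fun x => cint (- (h / 2)) (h / 2) (fun y => ((b l).[y / h])%:C * expi (ky * y)) *
    (((b k).[x / h])%:C * expi (kx * x))).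
  apply/funext => x; rewrite [RHS]mulrC -cintZ; last exact: ccont_scaled.
  by congr cint; apply/funext => y; rewrite rmorphM; ring.
rewrite cintZ; last exact: ccont_scaled.
rewrite /cmom invfM rmorphM; ring.
Qed.

Definition trace_hi K (k h : R) : C := \sum_(a < K.+1) chi b a * mom a k h.
Definition trace_lo K (k h : R) : C := \sum_(a < K.+1) clo b a * mom a k h.

(* Error of the central trace of the projected wave at a cell interface, where the
   exact wave has the value [expi (k * (h / 2))]. *)
Definition defect K (k h : R) : C :=
  (trace_hi K k h + expi (k * h) * trace_lo K k h) / 2 - expi (k * (h / 2)).

Lemma consistency K (k h : R) (i : 'I_K.+1) : 0 < h ->
  \sum_a central_mx b K (expi (k * h)) i a * mom a k h =
  'i%C * (k%:C * h%:C) * mom i k h +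
  (chi b i - clo b i / expi (k * h)) * defect K k h.
Proof.
move=> h0; have := cmom_ibp (b i) k h0.
rewrite (deriv_basis_expansion hb (ltnW (ltn_ord i))) cmom_sum.
move/(canRL (addKr _)) => ->.
rewrite -/(bhi b i) -/(blo b i) -/(chi b i) -/(clo b i) /defect /trace_hi /trace_lo.
(* The wave takes the values z and 1 / z at the right and left faces, so the cell phase is written
   as z squared. *)
have -> : expi (k * h) = expi (k * (h / 2)) ^+ 2 by rewrite expr2 -expiD -mulrDr -splitr.
move: (expi_neq0 (k * (h / 2))); move: (expi _) => z z0.
rewrite mulr_sumr -big_split/= mulr_suml.
have -> : \sum_a central_mx b K (z ^+ 2) i a * mom a k h =
   - (\sum_(a < K.+1) cmom (stiff b i a *: b a) k h) +
   (chi b i - clo b i / z ^+ 2) *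
   \sum_(a < K.+1) (chi b a * mom a k h + z ^+ 2 * (clo b a * mom a k h)) / 2.
  rewrite -sumrN mulr_sumr -big_split/=; apply: eq_bigr => a _.
  rewrite central_mxE cmomZ; field; exact: z0.
by rewrite mulrBr; field; exact: z0.
Qed.

Lemma lead_pint k : pint (b k * 'X^k) = (lc k)^-1.
Proof.
have sX : (size ('X^k : {poly R}) <= k.+1)%N by rewrite size_polyXn.
rewrite -['X^k](subrK ((('X^k : {poly R})`_k / lc k) *: b k)) mulrDr pintD.
rewrite (basis_orth hb) ?(size_sub_basis hb)// add0r -scalerAr pintZ.
by rewrite (basis_orthonormal hb) eqxx mulr1 coefXn eqxx div1r.
Qed.

(** Comparing the two formulas for [stiff b k.+1 k], by leading coefficients and by endpoint values,
    yields a recursion that fixes all leading coefficients. *)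
Lemma lead_succ k : lc k.+1 = 2 * bhi b k.+1 * bhi b k * lc k / k.+1%:R.
Proof.
have := stiff_succ hb k; rewrite (stiffE_bhi hb) leqnn addSn exprS exprD -expr2 sqrr_sign.
move=> E; have k0 : k.+1%:R != 0 :> R by rewrite pnatr_eq0.
have l0 := coef_basis_neq0 hb k.
apply/(mulIf k0); rewrite divfK//; apply/(mulIf (invr_neq0 l0)).
rewrite mulfK//; transitivity (k.+1%:R * (lc k.+1 / lc k)); first by ring.
by rewrite -E; ring.
Qed.

Lemma lead_0 : lc 0 = 1.
Proof.
have s0 := size_basis hb 0.
have : bhi b 0 = 1 by rewrite (bhiE hb) sqrtr1.
by rewrite /bhi [b 0%N]size1_polyC ?s0// coefC hornerC.
Qed.

Lemma cmom_bigO (p : {poly R}) k : bigOn 0 (cmom p k).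
Proof.
apply: eq_bigO (cmom_taylor 0 p k); apply: nearW => h.
by rewrite /cmom_jet big_ord0 subr0.
Qed.

(** Orthogonality removes the Taylor terms of degree below a, so the moment starts at h^a. *)
Lemma mom_lead a k : bigOn a.+1 (fun h => mom a k h -
  ('i%C * k%:C) ^+ a / (a`!)%:R * ((lc a)^-1)%:C * h%:C ^+ a).
Proof.
apply: eq_bigO (cmom_taylor a.+1 (b a) k); apply: nearW => h; congr (_ - _).
rewrite /cmom_jet big_ord_recr/= big1 ?add0r => [|j _].
  by rewrite lead_pint ['i%C * _]mulrA exprMn; ring.
by rewrite (basis_orth hb) ?mulr0// size_polyXn.
Qed.

Lemma mom_bigO a k : bigOn a (mom a k).
Proof.
have H := bigOD (bigOn_weak (leqnSn a) (mom_lead a k))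
  (bigO_cM (('i%C * k%:C) ^+ a / (a`!)%:R * ((lc a)^-1)%:C) (bigOn_X R a)).
by apply: eq_bigO H; apply: nearW => h; rewrite subrK.
Qed.

Lemma trace_jet K (s : R) (y : C) n : (n <= K.+1)%N ->
  cmom_jet n (\sum_(a < K.+1) (b a).[s] *: b a) y = expi_jet n (s%:C * y).
Proof.
move=> nK; apply: eq_bigr => j _.
have sX : (size ('X^j : {poly R}) <= K.+1)%N.
  by rewrite size_polyXn (leq_trans (ltn_ord j)).
have -> : pint ((\sum_(a < K.+1) (b a).[s] *: b a) * 'X^j) = s ^+ j.
  rewrite -[RHS]hornerXn [in RHS](basis_expansion hb sX) horner_sum.
  rewrite mulr_suml pint_sum; apply: eq_bigr => a _.
  by rewrite -scalerAl pintZ hornerZ mulrC.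
by rewrite rmorphXn !exprMn; ring.
Qed.

(* The kernel polynomial [\sum_a b_a(s) b_a] reproduces the point value at [s] up
   to degree [K]; in degree [K + 1] it misses exactly the [b K.+1] component. *)
Lemma trace_expansion K (s k : R) :
  bigOn K.+2 (fun h => \sum_(a < K.+1) (b a).[s]%:C * mom a k h - expi (k * s * h) +
   (('i%C * k%:C) ^+ K.+1 / (K.+1)`!%:R * ((lc K.+1)^-1)%:C * (b K.+1).[s]%:C) * h%:C ^+ K.+1).
Proof.
pose q n := \sum_(a < n) (b a).[s] *: b a.
have qE h : \sum_(a < K.+1) (b a).[s]%:C * mom a k h = cmom (q K.+1) k h.
  by rewrite cmom_sum; apply: eq_bigr => a _; rewrite cmomZ.
have H1 := cmom_taylor K.+2 (q K.+1) k.
have H2 := expi_taylor K.+2 (k * s).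
apply: eq_bigO (bigOB H1 H2); apply: nearW => h; rewrite qE.
suff -> : cmom_jet K.+2 (q K.+1) (k%:C * h%:C) = expi_jet K.+2 ((k * s)%:C * h%:C) -
   (('i%C * k%:C) ^+ K.+1 / (K.+1)`!%:R * ((lc K.+1)^-1)%:C * (b K.+1).[s]%:C) * h%:C ^+ K.+1.
  by ring.
have -> : (k * s)%:C * h%:C = s%:C * (k%:C * h%:C) :> C by rewrite rmorphM; ring.
(* With one more basis function the kernel reproduces degree K + 1 as well; the error is the term
   that this function contributes. *)
rewrite -(trace_jet s (k%:C * h%:C) (leqnn K.+2)) -/(q K.+2).
have -> : q K.+2 = q K.+1 + (b K.+1).[s] *: b K.+1 by rewrite /q big_ord_recr.
have jetD n p1 p2 y : cmom_jet n (p1 + p2) y = cmom_jet n p1 y + cmom_jet n p2 y :> C.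
  rewrite /cmom_jet -big_split/=; apply: eq_bigr => j _.
  by rewrite mulrDl pintD rmorphD mulrDr.
rewrite jetD -[LHS]addr0 -addrA; congr (_ + _).
rewrite /cmom_jet big_ord_recr/= big1 ?add0r => [|j _]; last first.
  rewrite -[X in pint X]scalerAl pintZ (basis_orth hb) ?mulr0//.
  by rewrite size_polyXn.
rewrite -[X in pint X]scalerAl pintZ lead_pint ['i%C * _]mulrA exprMn rmorphM; ring.
Qed.

Definition defect_coef K (k : R) : C :=
  ('i%C * k%:C) ^+ K.+1 / (K.+1)`!%:R * ((lc K.+1)^-1)%:C * chi b K.+1.

(** Both one-sided trace errors evaluate the same missing component, at opposite faces, so they
    differ by the sign (-1)^(K+1) and the phase. Leaving the phase unexpanded lets both parities of
    K follow from this formula. *)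
Lemma defect_expansion K (k : R) : bigOn K.+2 (fun h => defect K k h +
  defect_coef K k * ((1 + (-1) ^+ K.+1 * expi (k * h)) / 2) * h%:C ^+ K.+1).
Proof.
have H1 := trace_expansion K 2^-1 k.
have H2 := bigOnM (bigOn_expi k) (trace_expansion K (- 2^-1) k).
rewrite add0n in H2.
apply: eq_bigO (bigO_Mc (2^-1) (bigOD H1 H2)); apply: nearW => h.
have e1 : expi (k * 2^-1 * h) = expi (k * (h / 2)) by congr expi; ring.
have e2 : expi (k * h) * expi (k * - 2^-1 * h) = expi (k * (h / 2)).
  by rewrite -expiD; congr expi; field.
rewrite e1 -/(bhi b K.+1) -/(blo b K.+1) -/(chi b K.+1) -/(clo b K.+1).
rewrite (clo_parity hb) mulrDr mulrBr e2 /defect /trace_hi /trace_lo /defect_coef.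
have -> : \sum_(a < K.+1) ((b a).[2^-1])%:C * mom a k h = \sum_(a < K.+1) chi b a * mom a k h by [].
have -> : \sum_(a < K.+1) ((b a).[- 2^-1])%:C * mom a k h = \sum_(a < K.+1) clo b a * mom a k h by [].
field; rewrite fmorph_eq0 (coef_basis_neq0 hb) pnatr_eq0 -lt0n fact_gt0//.
Qed.

(* For even [K] the leading errors of the two traces have opposite signs. *)
Lemma defect_even K k : ~~ odd K -> bigOn K.+2 (defect K k).
Proof.
move=> eK; have H := bigO_cM (defect_coef K k / 2) (bigOnM (expi_m1_bigO k) (bigOn_X R K.+1)).
rewrite add1n in H.
apply: eq_bigO (bigOD (defect_expansion K k) H); apply: nearW => h.
by rewrite -signr_odd /= (negPf eK) /= expr1; field.
Qed.

Lemma defect_odd K k : odd K ->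
  bigOn K.+2 (fun h => defect K k h - (- defect_coef K k) * h%:C ^+ K.+1).
Proof.
move=> oK; have H := bigO_cM (defect_coef K k / 2) (bigOnM (expi_m1_bigO k) (bigOn_X R K.+1)).
rewrite add1n in H.
apply: eq_bigO (bigOB (defect_expansion K k) H); apply: nearW => h.
by rewrite -signr_odd /= oK /= expr0; field.
Qed.

Lemma defect_bigO K k : bigOn K.+1 (defect K k).
Proof.
have [oK|eK] := boolP (odd K); last exact: bigOn_weak (leqnSn _) (defect_even k eK).
have H := bigOD (bigOn_weak (leqnSn _) (defect_odd k oK))
   (bigO_cM (- defect_coef K k) (bigOn_X R K.+1)).
by apply: eq_bigO H; apply: nearW => h; rewrite subrK.
Qed.

End Consistency.

(** * Order barrier for odd degree, and a formula for the stationary error *)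

Section StationaryAccuracy.
Variables (R : realType) (b : nat -> {poly R}).
Hypothesis hb : orthonormal_basis b.
Local Open Scope classical_set_scope.
Local Notation C := R[i].
Local Notation mom a := (cmom (b a)).
Local Notation steadyh K kx ky h := (steady b K (Dp R) (Dp R) h h kx ky).
Local Notation phase k h := (expi (k * h)).

(* [f h = z * h ^ n + O(h ^ n.+1)] *)
Definition leads n (z : C) (f : R -> C) := bigOn n.+1 (fun h => f h - z * h%:C ^+ n).

Lemma leads_bigO n z f : leads n z f -> bigOn n f.
Proof.
move=> H; apply: eq_bigO (bigOD (bigOn_weak (leqnSn _) H) (bigO_cM z (bigOn_X R n))).
by apply: nearW => h; rewrite subrK.
Qed.

Lemma eq_leads n z f g : (\forall h \near (0 : R)^'+, f h = g h) -> leads n z f -> leads n z g.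
Proof. by move=> E; apply: eq_bigO; apply: filterS E => h ->. Qed.

Lemma leadsM n m z w f g : leads n z f -> leads m w g ->
  leads (n + m) (z * w) (fun h => f h * g h).
Proof.
move=> Hf Hg; have H1 := bigOnM Hf (leads_bigO Hg).
have H2 := bigO_cM z (bigOnM (bigOn_X R n) Hg).
rewrite addSn in H1; rewrite addnS in H2.
apply: eq_bigO (bigOD H1 H2); apply: nearW => h; rewrite exprD; ring.
Qed.

Lemma leadsD n z w f g : leads n z f -> leads n w g -> leads n (z + w) (fun h => f h + g h).
Proof.
by move=> Hf Hg; apply: eq_bigO (bigOD Hf Hg); apply: nearW => h; ring.
Qed.

Lemma leads_cM n z w f : leads n z f -> leads n (w * z) (fun h => w * f h).
Proof. by move=> H; apply: eq_bigO (bigO_cM w H); apply: nearW => h; ring. Qed.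

Lemma leads0 n f : bigOn n.+1 f -> leads n 0 f.
Proof. by apply: eq_bigO; apply: nearW => h; rewrite mul0r subr0. Qed.

(** A factor of size 1 / h is paid for with one order of the other factor. *)
Lemma bigOn_ratio n (f g : R -> C) : bigOn 0 (fun h => h%:C * f h) -> bigOn n.+1 g ->
  bigOn n (fun h => f h * g h).
Proof.
move=> Hf Hg; have := bigOnM Hf (bigOn_divh Hg); rewrite add0n; apply: eq_bigO.
apply: filterS (near0_gt0 R) => h h0; field.
by rewrite (inj_eq (@complexI _)) gt_eqF.
Qed.

(** The test function [b 0] has zero derivative, which leaves the flux difference across the cell
    with its factor 1 - 1 / t. *)
Lemma central_row0 K k a : bigOn 1 (fun h => central_mx b K (phase k h) 0 a).
Proof.
have H0 := bigO_cM (clo b a) (bigOn_expi k).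
have := bigOnM (expiV_m1_bigO k) (bigO_cM (chi b 0 / 2) (bigOD (bigOn_cst (chi b a)) H0)).
apply: eq_bigO; apply: nearW => h; rewrite central_mxE (stiff_upper hb)// (clo_parity hb 0) expr0 rmorph0.
by field; exact: expi_neq0.
Qed.

(** In the strong form the volume term against [b K] vanishes by degree, and odd parity makes the
    face factor 1 - 1 / t. *)
Lemma central_rowK K k a : odd K -> bigOn 1 (fun h => central_mx b K (phase k h) ord_max a).
Proof.
move=> oK; have H0 := bigO_cM (clo b a) (bigOn_expi k).
have := bigOnM (expiV_m1_bigO k) (bigO_cM (chi b K / 2) (bigOB H0 (bigOn_cst (chi b a)))).
apply: eq_bigO; apply: nearW => h.
rewrite central_mx_strong ?expi_neq0// (stiff_upper hb) ?leq_ord//.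
rewrite /= (clo_parity hb K) -signr_odd oK expr1 rmorph0.
by field; exact: expi_neq0.
Qed.

(** A constant trial function enters the strong form only through its jump t - 1. *)
Lemma central_col0 K k i : bigOn 1 (fun h => central_mx b K (phase k h) i 0).
Proof.
have H0 := bigO_cM (clo b i) (bigOn_expiV k).
have := bigOnM (expi_m1_bigO k) (bigO_cM (chi b 0 / 2) (bigOD (bigOn_cst (chi b i)) H0)).
apply: eq_bigO; apply: nearW => h.
rewrite central_mx_strong ?expi_neq0// (stiff_upper hb)// (clo_parity hb 0) expr0 rmorph0.
by field; exact: expi_neq0.
Qed.

Lemma central_bigO K k i a : bigOn 0 (fun h => central_mx b K (phase k h) i a).
Proof.
have H1 := bigOB (bigOn_cst (chi b i)) (bigO_cM (clo b i) (bigOn_expiV k)).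
have H2 := bigO_cM (2^-1) (bigOD (bigOn_cst (chi b a)) (bigO_cM (clo b a) (bigOn_expi k))).
have := bigOD (bigOn_cst (- (stiff b i a)%:C)) (bigOnM H1 H2).
apply: eq_bigO; apply: nearW => h; rewrite central_mxE.
by field; exact: expi_neq0.
Qed.

Definition residual K k i (h : R) : C :=
  (chi b i - clo b i / phase k h) * defect b K k h.

(** The face factor of [b 0] is 1 - 1 / t, which adds one order to the defect. *)
Lemma residual_0 K k : bigOn K.+2 (residual K k 0).
Proof.
have := bigOnM (bigO_cM (chi b 0) (expiV_m1_bigO k)) (defect_bigO hb K k).
apply: eq_bigO; apply: nearW => h; rewrite /residual (clo_parity hb) expr0; ring.
Qed.

(** For odd K the face factor is 1 + 1 / t and tends to 2, so the defect appears at its full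
    size. *)
Lemma residual_top K k : odd K ->
  leads K.+1 (2 * chi b K * - defect_coef b K k) (residual K k K).
Proof.
move=> oK; have L0 : leads 0 (2 * chi b K) (fun h => chi b K - clo b K / phase k h).
  have := bigO_cM (- chi b K) (expiV_m1_bigO k).
  apply: eq_bigO; apply: nearW => h; rewrite (clo_parity hb) -signr_odd oK expr0 expr1; ring.
exact: leadsM L0 (defect_odd hb k oK).
Qed.

Lemma residual_bigO K k i n : bigOn n (defect b K k) -> bigOn n (residual K k i).
Proof.
move=> H; have H0 := bigO_cM (clo b i) (bigOn_expiV k).
exact: bigOnM (bigOB (bigOn_cst (chi b i)) H0) H.
Qed.

Lemma mom0_leads k : leads 0 1 (mom 0 k).
Proof.
apply: eq_bigO (mom_lead hb 0 k); apply: nearW => h.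
by rewrite !expr0 fact0 (lead_0 hb) !invr1 !mulr1.
Qed.

Lemma Qhat0 (kx ky : R) : Qhat kx ky 0 0 = (- ky)%:C. Proof. by rewrite mxE. Qed.
Lemma Qhat1 (kx ky : R) : Qhat kx ky 1 0 = kx%:C. Proof. by rewrite mxE. Qed.
Lemma Qhat2 (kx ky : R) : Qhat kx ky 2 0 = 0 :> C. Proof. by rewrite mxE. Qed.

(* Rows [0] and [K] of the derivative matrix are O(h) for odd [K], so an O(h ^ p)
   error contributes O(h ^ (p + 1)) to entry [(0, K)] of the balance equation, while
   the degrees of freedom of the wave contribute a multiple of h ^ (K + 1). *)
Lemma no_higher_order K (kx ky : R) (P : R -> 'cV[C]_(ndof K) -> 'cV[C]_(ndof K)) (p : R) :
  odd K -> kx != 0 -> ky != 0 -> K%:R < p ->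
  (\forall h \near (0 : R)^'+, forall q, P h q \in steadyh K kx ky h) ->
  ~ vec_bigO (fun h => DOF b K h h kx ky - P h (DOF b K h h kx ky)) p.
Proof.
move=> oK kx0 ky0 Kp PS Hp.
pose err c (k l : 'I_K.+1) h := (DOF b K h h kx ky - P h (DOF b K h h kx ky)) (dof c k l) 0.
have Herr c k l : bigO (fun h => h `^ p) (err c k l) by exact: Hp.
pose E h := - ky%:C * (mom K ky h * residual K kx 0 h) + kx%:C * (mom 0 kx h * residual K ky K h).
pose S h := \sum_a central_mx b K (phase kx h) 0 a * err 0 a ord_max h +
            \sum_a central_mx b K (phase ky h) ord_max a * err 1 0 a h.
have HS : bigO (fun h => h ^+ 1 * h `^ p) S.
  apply: bigOD; apply: bigO_sum => a; apply: bigOM => //.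
    exact: central_row0.
  exact: central_rowK.
(* The projected state balances exactly, and the consistent parts of the wave cancel by -ky kx + kx
   ky = 0; only the residuals survive. *)
have SE : \forall h \near (0 : R)^'+, S h = E h.
  apply: filterS3 PS (near0_gt0 R) (near_regular K kx0) => h PS h0 reg.
  have hn : (h%:C)^-1 != 0 :> C by rewrite invr_eq0 (inj_eq (@complexI _)) gt_eqF.
  have [_ /eqP] := (mem_steadyD hb h0 h0 _ (or_introl reg)).1 (PS (DOF b K h h kx ky)).
  rewrite -scalerDr scaler_eq0 (negPf hn)/= => /eqP /matrixP /(_ 0 ord_max).
  rewrite mx_entryD !mxE; set Q := P h _ => EQ.
  have errE c k l : err c k l h = Qhat kx ky c 0 * (mom k kx h * mom l ky h) - comp c Q k l.
    by rewrite /err mxE DOF_comp// !mxE.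
  rewrite /S.
  have -> : \sum_a central_mx b K (phase kx h) 0 a * err 0 a ord_max h =
    - ky%:C * mom K ky h * (\sum_a central_mx b K (phase kx h) 0 a * mom a kx h)
    - \sum_a central_mx b K (phase kx h) 0 a * comp 0 Q a ord_max.
    rewrite mulr_sumr -sumrB; apply: eq_bigr => a _; rewrite errE Qhat0 rmorphN /=; ring.
  have -> : \sum_a central_mx b K (phase ky h) ord_max a * err 1 0 a h =
    kx%:C * mom 0 kx h * (\sum_a central_mx b K (phase ky h) ord_max a * mom a ky h)
    - \sum_a comp 1 Q 0 a * (central_mx b K (phase ky h))^T a ord_max.
    rewrite mulr_sumr -sumrB; apply: eq_bigr => a _.
    rewrite errE Qhat1 [_^T a _]mxE /=; ring.
  rewrite !(consistency hb)// /E /residual /=.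
  move: EQ; move: (\sum_j _) (\sum_j _) => s1 s2 /eqP; rewrite addr_eq0 => /eqP ->.
  ring.
have HE : bigO (fun h => h ^+ 1 * h `^ p) E by apply: eq_bigO HS; exact: SE.
(* The x-residual against [b 0] has one order to spare, so the leading coefficient comes from the
   y-residual against [b K]. *)
have HL : leads K.+1 (kx%:C * (1 * (2 * chi b K * - defect_coef b K ky))) E.
  have H1 := bigO_cM (- ky%:C) (bigOnM (cmom_bigO (b K) ky) (residual_0 K kx)).
  have := leadsD (leads0 H1) (leads_cM kx%:C (leadsM (mom0_leads kx) (residual_top ky oK))).
  by rewrite add0r.
apply: (leading_contra _ HL HE); last exact: powR_small.
have nC (x : R) : x != 0 -> x%:C != 0 :> C by rewrite (inj_eq (@complexI _)).
have ni : 'i%C != 0 :> C by rewrite -normr_gt0 norm_i.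
have fn : (K.+1)`!%:R^-1 != 0 :> C by rewrite invr_eq0 pnatr_eq0 -lt0n fact_gt0.
have dn : defect_coef b K ky != 0.
  apply: mulf_neq0 (chi_neq0 hb _); apply: mulf_neq0.
    by apply: mulf_neq0 fn; rewrite expf_neq0// mulf_neq0// nC.
  by apply: nC; rewrite invr_eq0 (coef_basis_neq0 hb).
apply: mulf_neq0 (nC _ kx0) _; rewrite mul1r; apply: mulf_neq0; last by rewrite oppr_eq0.
by apply: mulf_neq0 (chi_neq0 hb _); rewrite pnatr_eq0.
Qed.

(* Selective optimality is pointwise in [q]; affinity makes it uniform on bounded
   families, which is needed since the degrees of freedom depend on [h]. *)
Lemma optimal_close K (S : R -> {vspace 'cV[C]_(ndof K)}) I P (D : R -> 'cV[C]_(ndof K)) :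
  selectively_optimal S I P -> (forall j, bigOn 0 (fun h => D h j 0)) ->
  forall i, i \in I -> bigOn K.+1 (fun h => P h (D h) i 0 - D h i 0).
Proof.
move=> [_ PA PI] DO i iI.
have P0 : bigOn K.+1 (fun h => P h 0 i 0).
  have := (scal_bigO_nat _ _).2 (PI 0 i iI); apply: eq_bigO; apply: nearW => h.
  by rewrite !mxE subr0.
have Pe j : bigOn K.+1 (fun h => P h (delta_mx j 0) i 0 - (delta_mx j 0 : 'cV[C]_(ndof K)) i 0).
  exact: (scal_bigO_nat _ _).2 (PI (delta_mx j 0) i iI).
(* Subtracting [P h 0] leaves the linear part: in row i, column j of its matrix differs from the
   identity by O(h^(K+1)). *)
have Psum : bigOn K.+1 (fun h => \sum_j ((P h (delta_mx j 0) i 0 -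
    (delta_mx j 0 : 'cV[C]_(ndof K)) i 0) - P h 0 i 0) * D h j 0).
  by apply: bigO_sum => j; have := bigOnM (bigOB (Pe j) P0) (DO j); rewrite addn0.
apply: eq_bigO (bigOD P0 Psum); apply: filterS PA => h [[A [c PE]] _].
rewrite !PE mulmx0 add0r.
have -> : (A *m D h + c) i 0 - D h i 0 = c i 0 + (\sum_j A i j * D h j 0 - D h i 0).
  by rewrite mxE mxE; ring.
congr (_ + _).
have -> : D h i 0 = \sum_j (delta_mx j 0 : 'cV[C]_(ndof K)) i 0 * D h j 0.
  rewrite (bigD1 i)//= mxE !eqxx mul1r big1 ?addr0// => j ji.
  by rewrite mxE eq_sym (negPf ji) mul0r.
rewrite -sumrB; apply: eq_bigr => j _; rewrite PE -mulrBl; congr (_ * _).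
have -> : (A *m delta_mx j 0 + c) i 0 = A i j + c i 0.
  rewrite mxE; congr (_ + _); rewrite mxE (bigD1 j)//= big1 ?addr0 => [|a aj].
    by rewrite mxE !eqxx mulr1.
  by rewrite mxE (negPf aj) mulr0.
ring.
Qed.

Lemma DOF_bigO K kx ky j : bigOn 0 (fun h => DOF b K h h kx ky j 0).
Proof.
elim/dof_ind: j => c k l.
have := bigO_cM (Qhat kx ky c 0) (bigOnM (cmom_bigO (b k) kx) (cmom_bigO (b l) ky)).
by apply: eq_bigO; apply: filterS (near0_gt0 R) => h h0; rewrite DOF_comp.
Qed.

(* Multiplying [A m = i kx h m + residual] by [B = A^-1] gives
   [i kx h (B m) = m - B residual]; the exact parts of [U] cancel and only products
   with residuals remain. *)
Lemma error_decomposition K (kx ky h : R) (B : 'M[C]_K.+1) Q (k l : 'I_K.+1) :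
  0 < h -> kx != 0 -> regular_mode K (phase kx h) ->
  central_mx b K (phase kx h) *m B = 1%:M -> Q \in steadyh K kx ky h ->
  (DOF b K h h kx ky - Q) (dof 0 k l) 0 =
    (mom k kx h * residual K ky l h - (\sum_j B k j * residual K kx j h) *
      ('i%C * ky%:C * h%:C * mom l ky h + residual K ky l h)) / ('i%C * h%:C)
    - \sum_a \sum_c B k a * central_mx b K (phase ky h) l c *
        (DOF b K h h kx ky - Q) (dof 1 a c) 0.
Proof.
move=> h0 kx0 reg AB QS.
have nC (x : R) : x != 0 -> x%:C != 0 :> C by rewrite (inj_eq (@complexI _)).
have ni : 'i%C != 0 :> C by rewrite -normr_gt0 norm_i.
have hn : h%:C != 0 :> C by rewrite nC// gt_eqF.
have UQ := steady_comp0 hb h0 h0 reg QS.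
have uA := central_mx_unit hb (expi_neq0 _) reg.
have BE : invmx (central_mx b K (phase kx h)) = B by rewrite -[LHS]mulmx1 -AB mulKmx.
have BA : B *m central_mx b K (phase kx h) = 1%:M by rewrite -BE mulVmx.
rewrite BE divff// scaleN1r in UQ.
set A' := central_mx b K (phase ky h) in UQ *.
have E0 : (DOF b K h h kx ky - Q) (dof 0 k l) 0 =
    - ky%:C * (mom k kx h * mom l ky h) + \sum_a \sum_c B k a * A' l c * comp 1 Q a c.
  have -> : (DOF b K h h kx ky - Q) (dof 0 k l) 0 =
     DOF b K h h kx ky (dof 0 k l) 0 - comp 0 Q k l by rewrite !mxE.
  rewrite DOF_comp// Qhat0 UQ mx_entryN opprK rmorphN; congr (_ + _).
  rewrite mxE exchange_big/=; apply: eq_bigr => c _.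
  rewrite [_^T c l]mxE mxE mulr_suml; apply: eq_bigr => a _; ring.
have BM : 'i%C * kx%:C * h%:C * (\sum_a B k a * mom a kx h) =
    mom k kx h - \sum_j B k j * residual K kx j h.
  have : \sum_j B k j * (\sum_a central_mx b K (phase kx h) j a * mom a kx h) = mom k kx h.
    under eq_bigr do rewrite mulr_sumr.
    rewrite exchange_big/=.
    transitivity (\sum_a (1%:M : 'M[C]_K.+1) k a * mom a kx h).
      apply: eq_bigr => a _; rewrite -BA mxE mulr_suml.
      by apply: eq_bigr => j _; rewrite mulrA.
    rewrite (bigD1 k)//= big1 ?addr0 ?mxE ?eqxx ?mul1r// => a ak.
    by rewrite mxE eq_sym (negPf ak) mul0r.
  move=> <-; rewrite -sumrB mulr_sumr; apply: eq_bigr => j _.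
  by rewrite consistency// /residual; ring.
have AN : \sum_c A' l c * mom c ky h = 'i%C * ky%:C * h%:C * mom l ky h + residual K ky l h.
  by rewrite /A' consistency// /residual; ring.
have E1 : \sum_a \sum_c B k a * A' l c * (DOF b K h h kx ky - Q) (dof 1 a c) 0 =
   kx%:C * (\sum_a B k a * mom a kx h) * (\sum_c A' l c * mom c ky h)
   - \sum_a \sum_c B k a * A' l c * comp 1 Q a c.
  rewrite -mulrA mulr_suml mulr_sumr -sumrB; apply: eq_bigr => a _.
  rewrite !mulr_sumr -sumrB; apply: eq_bigr => c _.
  have -> : (DOF b K h h kx ky - Q) (dof 1 a c) 0 =
     DOF b K h h kx ky (dof 1 a c) 0 - comp 1 Q a c by rewrite !mxE.
  rewrite DOF_comp// Qhat1; ring.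
rewrite E0 E1 -AN.
have -> : \sum_j B k j * residual K kx j h =
   mom k kx h - 'i%C * kx%:C * h%:C * (\sum_a B k a * mom a kx h) by rewrite BM opprB addrC subrK.
have -> : residual K ky l h = \sum_c A' l c * mom c ky h - 'i%C * ky%:C * h%:C * mom l ky h.
  by rewrite AN addrC addKr.
move: (\sum_a B _ _ * _) (\sum_c A' _ _ * _) (\sum_a _) => x y z.
by field; rewrite hn ni.
Qed.

End StationaryAccuracy.

(** * Growth of the explicit inverses as the phase tends to 1 *)

Section InverseAsymptotics.
Variable R : realType.
Local Open Scope classical_set_scope.
Local Notation C := R[i].
Local Notation phase k h := (expi (k * h)).

Lemma iC_neq0 : 'i%C != 0 :> C.
Proof. by rewrite -normr_gt0 norm_i. Qed.

Lemma realC_neq0 (x : R) : x != 0 -> x%:C != 0 :> C.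
Proof. by rewrite (inj_eq (@complexI _)). Qed.

Lemma leads_inv (z : C) (f : R -> C) : z != 0 -> leads 1 z f ->
  leads 0 z^-1 (fun h => h%:C / f h).
Proof.
move=> z0 H; have H1 := bigO_cM (- z^-1) (bigOnM (bigOn_divh H) (bigOn_inv z0 H)).
apply: eq_bigO H1; apply: filterS2 (leading_neq0 z0 H) (near0_gt0 R) => h f0 h0.
rewrite !expr1 expr0; field.
by rewrite f0 z0 realC_neq0// gt_eqF.
Qed.

Lemma leads_h (z : C) : leads 1 z (fun h => z * h%:C).
Proof. by apply: eq_bigO (bigO0 _); apply: nearW => h; rewrite expr1 subrr. Qed.

Lemma leads_phase1 (k : R) : leads 0 2 (fun h => 1 + phase k h).
Proof. by apply: eq_bigO (expi_m1_bigO k); apply: nearW => h; rewrite expr0; ring. Qed.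

Lemma hX_leads (k : R) : k != 0 -> leads 0 (2 / ('i%C * k%:C)) (fun h => h%:C * X_of (phase k h)).
Proof.
move=> k0; have z0 : 'i%C * k%:C != 0 :> C by rewrite mulf_neq0 ?iC_neq0 ?realC_neq0.
apply: eq_leads (leadsM (leads_phase1 k) (leads_inv z0 (expi_m1 k))).
by apply: nearW => h; rewrite /X_of mulrCA.
Qed.

Lemma Xinv_bigO (k : R) : bigOn 0 (fun h => (X_of (phase k h))^-1).
Proof.
have n2 : 2 != 0 :> C by rewrite pnatr_eq0.
have := bigOnM (bigOn_weak (leq0n _) (expi_m1_bigO k)) (bigOn_inv n2 (leads_phase1 k)).
by apply: eq_bigO; apply: nearW => h; rewrite /X_of invfM invrK expr0 mul1r mulrC.
Qed.

Lemma bigOn_hc (z : C) : bigOn 0 (fun h => h%:C * z).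
Proof. exact: bigOn_weak (bigO_Mc z (bigOn_h R)). Qed.

Lemma leads_divih n (z : C) (f : R -> C) : leads n.+1 z f ->
  bigOn n.+1 (fun h => f h / ('i%C * h%:C) - z / 'i%C * h%:C ^+ n).
Proof.
move=> H; apply: eq_bigO (bigO_cM ('i%C)^-1 (bigOn_divh H)).
apply: filterS (near0_gt0 R) => h h0; rewrite exprS; field.
by rewrite iC_neq0 realC_neq0// gt_eqF.
Qed.

Lemma bigOn_divih n (f : R -> C) : bigOn n.+1 f -> bigOn n (fun h => f h / ('i%C * h%:C)).
Proof.
move=> H; apply: eq_bigO (bigO_cM ('i%C)^-1 (bigOn_divh H)).
by apply: nearW => h; rewrite invfM; ring.
Qed.

Lemma h_central_inv1 (k : R) i j : k != 0 -> bigOn 0 (fun h => h%:C * central_inv1 (phase k h) i j).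
Proof.
move=> k0; have HX := leads_bigO (hX_leads k0).
apply: (eq_bigO (e := fun h => h%:C * nth 0 (nth [::]
  [:: [:: X_of (phase k h) / 2; - (2 * (Num.sqrt 3)%:C)^-1];
      [:: (2 * (Num.sqrt 3)%:C)^-1; - (X_of (phase k h) / 6)]] i) j)).
  by apply: nearW => h; rewrite mxE.
case: i j => [[|[|//]] ?] [[|[|//]] ?] /=; try exact: bigOn_hc.
- by apply: eq_bigO (bigO_Mc 2^-1 HX); apply: nearW => h; rewrite mulrA.
- by apply: eq_bigO (bigO_Mc (- 6^-1) HX); apply: nearW => h; ring.
Qed.

Lemma central_inv2_bigO (k : R) i (j : 'I_3) : j != 0 -> bigOn 0 (fun h => central_inv2 (phase k h) i j).
Proof.
move=> j0.
apply: (eq_bigO (e := fun h => nth 0 (nth [::]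
  [:: [:: X_of (phase k h) / 2; - (2 * (Num.sqrt 3)%:C)^-1; 0];
      [:: (2 * (Num.sqrt 3)%:C)^-1; 0; - (2 * (Num.sqrt 3)%:C * (Num.sqrt 5)%:C)^-1];
      [:: 0; (2 * (Num.sqrt 3)%:C * (Num.sqrt 5)%:C)^-1; - (10 * X_of (phase k h))^-1]] i) j)).
  by apply: nearW => h; rewrite mxE.
case: i j j0 => [[|[|[|//]]] ?] [[|[|[|//]]] ?] //= _; try exact: bigOn_cst.
apply: eq_bigO (bigO_cM (- 10^-1) (Xinv_bigO k)); apply: nearW => h.
by rewrite [(10 * _)^-1]invfM mulNr.
Qed.

Lemma h_central_inv2 (k : R) i j : k != 0 -> bigOn 0 (fun h => h%:C * central_inv2 (phase k h) i j).
Proof.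
move=> k0; have [->|j0] := eqVneq j 0; last first.
  exact: bigOn_weak (leq0n _) (bigOnM (bigOn_h R) (central_inv2_bigO k i j0)).
have HX := leads_bigO (hX_leads k0).
apply: (eq_bigO (e := fun h => h%:C * nth 0
  [:: X_of (phase k h) / 2; (2 * (Num.sqrt 3)%:C)^-1; 0] i)).
  by apply: nearW => h; rewrite mxE; case: i => [[|[|[|//]]] ?].
case: i => [[|[|[|//]]] ?] /=; try exact: bigOn_hc.
by apply: eq_bigO (bigO_Mc 2^-1 HX); apply: nearW => h; rewrite mulrA.
Qed.

End InverseAsymptotics.

(** * Stationary accuracy for K = 1 and K = 2 *)

Section LowDegrees.
Variables (R : realType) (b : nat -> {poly R}).
Hypothesis hb : orthonormal_basis b.
Local Open Scope classical_set_scope.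
Local Notation C := R[i].
Local Notation mom a := (cmom (b a)).
Local Notation steadyh K kx ky h := (steady b K (Dp R) (Dp R) h h kx ky).
Local Notation phase k h := (expi (k * h)).
Local Notation res K k i := (residual b K k i).
Local Notation sq3 := ((Num.sqrt 3)%:C : C).

Lemma wave_mom_bigO l k : bigOn l.+1 (fun h => 'i%C * k%:C * h%:C * mom l k h).
Proof. exact: bigOnM (bigO_cM ('i%C * k%:C) (bigOn_h R)) (mom_bigO hb l k). Qed.

(** The endpoint value sqrt 5 of [b 2] divided by its leading coefficient 6 sqrt 5 is 1/6; with (i
    k)^2 / 2 this gives the 12. *)
Lemma defect_coef1 k : - defect_coef b 1 k = k%:C ^+ 2 / 12.
Proof.
have b0 : bhi b 0 = 1 by rewrite (bhiE hb) sqrtr1.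
have b2 := gt_eqF (bhi_gt0 hb 2).
have -> : defect_coef b 1 k = ('i%C * k%:C) ^+ 2 / 2 * (((b 2)`_2)^-1 * bhi b 2)%:C.
  by rewrite /defect_coef rmorphM /= mulrA.
have -> : ((b 2)`_2)^-1 * bhi b 2 = 6^-1.
  have b1 : bhi b 1 ^+ 2 = 3 by rewrite (bhi_sqr hb).
  rewrite !(lead_succ hb) (lead_0 hb) b0; field: b1.
  by rewrite b2 gt_eqF// bhi_gt0.
by rewrite fmorphV rmorph_nat exprMn sqr_i; field.
Qed.

Lemma residual1_1 k : leads 2 (sq3 * k%:C ^+ 2 / 6) (res 1 k 1).
Proof.
have := residual_top hb (K := 1) k isT; rewrite defect_coef1 (chiE hb).
by congr leads; field.
Qed.

Section DegreeOne.
Variables kx ky : R.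
Hypothesis kx0 : kx != 0.
(** [F], [G] and the numerator [N] are the pieces of the right-hand side of
    [error_decomposition]. *)
Let B h := central_inv1 (phase kx h).
Let F (k : 'I_2) h := \sum_j B h k j * res 1 kx j h.
Let G (l : 'I_2) h := 'i%C * ky%:C * h%:C * mom l ky h + res 1 ky l h.
Let N (k l : 'I_2) h := mom k kx h * res 1 ky l h - F k h * G l h.

(** The pole X multiplies the residual against [b 0], which has an order to spare. *)
Let F0 : bigOn 2 (F 0).
Proof.
have H0 := bigO_cM 2^-1 (bigOn_ratio (leads_bigO (hX_leads kx0)) (residual_0 hb 1 kx)).
have H1 := bigO_cM (- (2 * sq3)^-1) (leads_bigO (residual1_1 kx)).
apply: eq_bigO (bigOD H0 H1); apply: nearW => h.
by rewrite /F !big_ord_recl big_ord0 /B !mxE /=; ring.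
Qed.

(** Here the pole X multiplies the residual against [b 1], and an order is lost; this produces the
    kx ky entry of the error. *)
Let F1 : leads 1 (- (2 / ('i%C * kx%:C)) * (sq3 * kx%:C ^+ 2 / 6) / 6) (F 1).
Proof.
have H0 := leads0 (bigOn_weak (leqnSn _) (bigO_cM (2 * sq3)^-1 (residual_0 hb 1 kx))).
have H1 : leads 1 (2 / ('i%C * kx%:C) * (sq3 * kx%:C ^+ 2 / 6))
    (fun h => X_of (phase kx h) * res 1 kx 1 h).
  have L : leads 1 (sq3 * kx%:C ^+ 2 / 6) (fun h => res 1 kx 1 h / h%:C).
    apply: eq_bigO (bigOn_divh (residual1_1 kx)); apply: filterS (near0_gt0 R) => h h0.
    by field; rewrite realC_neq0// gt_eqF.
  apply: eq_leads (leadsM (hX_leads kx0) L); apply: filterS (near0_gt0 R) => h h0.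
  by field; rewrite realC_neq0// gt_eqF.
have := leadsD H0 (leads_cM (- 6^-1) H1); rewrite add0r => H2.
have H3 : leads 1 (- 6^-1 * (2 / ('i%C * kx%:C) * (sq3 * kx%:C ^+ 2 / 6))) (F 1).
  apply: eq_leads H2; apply: nearW => h.
  by rewrite /F !big_ord_recl big_ord0 /B !mxE /=; ring.
by move: H3; congr leads; ring.
Qed.

Let G0 : leads 1 ('i%C * ky%:C) (G 0).
Proof.
have H := leadsM (leads_h ('i%C * ky%:C)) (mom0_leads hb ky).
have := leadsD H (leads0 (bigOn_weak (leqnSn _) (residual_0 hb 1 ky))).
by rewrite mulr1 addr0.
Qed.

Let G1 : bigOn 2 (G 1).
Proof. exact: bigOD (wave_mom_bigO 1 ky) (leads_bigO (residual1_1 ky)). Qed.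

(** Numerators of order 3 become negligible after division by i h. The ky^2 entry stems from the
    y-residual against [b 1], the kx ky entry from the product of [F 1] and [G 0]. *)
Lemma leading1_accuracy (k l : 'I_2) :
  bigOn 2 (fun h => N k l h / ('i%C * h%:C) - leading1 kx ky h (dof 0 k l) 0).
Proof.
have N00 : bigOn 3 (N 0 0).
  exact: bigOB (bigOnM (cmom_bigO _ kx) (residual_0 hb 1 ky)) (bigOnM F0 (leads_bigO G0)).
have N01 : leads 2 (sq3 * ky%:C ^+ 2 / 6) (N 0 1).
  have H1 := leads0 (bigOn_weak (leqnSn _) (bigON (bigOnM F0 G1))).
  have := leadsD (leadsM (mom0_leads hb kx) (residual1_1 ky)) H1.
  by rewrite mul1r addr0.
have N10 : leads 2 (- ((- (2 / ('i%C * kx%:C)) * (sq3 * kx%:C ^+ 2 / 6) / 6) * ('i%C * ky%:C)))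
    (N 1 0).
  have H1 := leads0 (bigOn_weak (leqnSn _) (bigOnM (mom_bigO hb 1 kx) (residual_0 hb 1 ky))).
  have H2 := leads_cM (-1) (leadsM F1 G0).
  have := leadsD H1 H2; rewrite add0r => H3.
  have : leads 2 (-1 * ((- (2 / ('i%C * kx%:C)) * (sq3 * kx%:C ^+ 2 / 6) / 6) * ('i%C * ky%:C)))
    (N 1 0) by apply: eq_leads H3; apply: nearW => h; rewrite mulN1r.
  by rewrite mulN1r.
have N11 : bigOn 3 (N 1 1).
  exact: bigOB (bigOnM (mom_bigO hb 1 kx) (leads_bigO (residual1_1 ky)))
    (bigOnM (leads_bigO F1) G1).
have s0 := @sqC_neq0 R 2; have s2 := @sqC_sqr R 3; have i0 := iC_neq0 R.
have k0 := realC_neq0 kx0; have i2 := @sqr_i R.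
have dofE (i j : 'I_2) h : leading1 kx ky h (dof 0 i j) 0 =
    nth 0 [:: 0; - ('i%C * (h * ky ^+ 2)%:C / (2 * sq3));
                 - ('i%C * (h * kx * ky)%:C / (6 * sq3)); 0] (i * 2 + j).
  by rewrite mxE; case: i j => [[|[|//]] ?] [[|[|//]] ?].
case: k l => [[|[|//]] ik] [[|[|//]] il].
- rewrite (_ : Ordinal ik = 0); last exact: val_inj.
  rewrite (_ : Ordinal il = 0); last exact: val_inj.
  by apply: eq_bigO (bigOn_divih N00); apply: nearW => h; rewrite dofE subr0.
- rewrite (_ : Ordinal ik = 0); last exact: val_inj.
  rewrite (_ : Ordinal il = 1); last exact: val_inj.
  apply: eq_bigO (leads_divih N01); apply: nearW => h; rewrite dofE /=; congr (_ - _).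
  rewrite rmorphM rmorphXn /= expr1; move: s0 s2; move: sq3 => x x0 x2.
  by field: i2 x2; rewrite i0 x0.
- rewrite (_ : Ordinal ik = 1); last exact: val_inj.
  rewrite (_ : Ordinal il = 0); last exact: val_inj.
  apply: eq_bigO (leads_divih N10); apply: nearW => h; rewrite dofE /=; congr (_ - _).
  rewrite !rmorphM /= expr1; move: s0 s2; move: sq3 => x x0 x2.
  by field: i2 x2; rewrite i0 x0 k0.
- rewrite (_ : Ordinal ik = 1); last exact: val_inj.
  rewrite (_ : Ordinal il = 1); last exact: val_inj.
  by apply: eq_bigO (bigOn_divih N11); apply: nearW => h; rewrite dofE subr0.
Qed.

Lemma first_order_error (P : R -> 'cV[C]_(ndof 1) -> 'cV[C]_(ndof 1)) :
  selectively_optimal (fun h => steadyh 1 kx ky h) (v_entries 1) P ->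
  vec_bigO (fun h => DOF b 1 h h kx ky - P h (DOF b 1 h h kx ky) - leading1 kx ky h) 2.
Proof.
move=> so; have [_ PS _] := so.
pose D h := DOF b 1 h h kx ky; pose E h := D h - P h (D h).
have Ev (k l : 'I_2) : bigOn 2 (fun h => E h (dof 1 k l) 0).
  have vi : dof 1 k l \in v_entries 1 by rewrite inE field_of_dof.
  have := bigON (optimal_close so (@DOF_bigO _ b 1 kx ky) vi).
  by apply: eq_bigO; apply: nearW => h; rewrite /E !mxE opprB.
elim/dof_ind => c k l; apply/scal_bigO_nat.
have leadE (c' : 'I_3) h : c' != 0 -> leading1 kx ky h (dof c' k l) 0 = 0.
  rewrite mxE; elim/ord3_ind: c' => // _;
    by case: k l => [[|[|//]] ?] [[|[|//]] ?].
elim/ord3_ind: c.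
- have H1 : bigOn 2 (fun h => \sum_a \sum_c B h k a * central_mx b 1 (phase ky h) l c *
      E h (dof 1 a c) 0).
    apply: bigO_sum => a; apply: bigO_sum => c.
    (* For K = 1 the rows 0 and K are all the rows, so the whole y-matrix is O(h) and absorbs the
       pole of the inverse. *)
    have Arow : bigOn 1 (fun h => central_mx b 1 (phase ky h) l c).
      clear leadE; case: l => [[|[|//]] il].
        by rewrite (_ : Ordinal il = 0); [exact: central_row0|exact: val_inj].
      by rewrite (_ : Ordinal il = ord_max); [exact: central_rowK|exact: val_inj].
    exact: bigOnM (bigOn_ratio (h_central_inv1 k a kx0) Arow) (Ev a c).
  apply: eq_bigO (bigOB (leading1_accuracy k l) H1).
  apply: filterS3 PS (near0_gt0 R) (near_regular 1 kx0) => h [_ PS] h0 reg.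
  have /andP[t1 _] := reg.
  have AB := mul_central_inv1 hb (expi_neq0 _) t1.
  rewrite [in RHS]mx_entryD mx_entryN (error_decomposition hb k l h0 kx0 reg AB (PS (D h))).
  by rewrite -/(B h) -/(D h) -/(E h) /N /F /G; ring.
- apply: eq_bigO (Ev k l); apply: nearW => h.
  by rewrite [RHS]mx_entryD mx_entryN leadE// subr0.
- apply: eq_bigO (bigO0 _).
  apply: filterS3 PS (near0_gt0 R) (near_regular 1 kx0) => h [_ PS] h0 reg.
  rewrite [RHS]mx_entryD mx_entryN leadE// subr0 mx_entryD mx_entryN DOF_comp// Qhat2 mul0r.
  have [/matrixP/(_ k l) + _] := (mem_steadyD hb h0 h0 _ (or_introl reg)).1 (PS (D h)).
  by rewrite !mxE => ->; rewrite subrr.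
Qed.

End DegreeOne.

Section DegreeTwo.
Variables (kx ky : R) (a : 'I_9 -> C).
Hypothesis kx0 : kx != 0.

Lemma residual2_bigO k i : bigOn 4 (res 2 k i).
Proof. by apply: residual_bigO => //; exact: defect_even. Qed.

(** The residuals have order 4. In the product term the pole costs one order and the O(h) factor of
    the wave returns it, so the final division by h leaves order 3 throughout. *)
Lemma second_order_terms (k l : 'I_3) :
  bigOn 3 (fun h => (mom k kx h * res 2 ky l h -
    (\sum_j central_inv2 (phase kx h) k j * res 2 kx j h) *
      ('i%C * ky%:C * h%:C * mom l ky h + res 2 ky l h)) / ('i%C * h%:C)).
Proof.
apply: bigOn_divih; apply: bigOB.
  exact: bigOnM (cmom_bigO _ kx) (residual2_bigO ky l).
have HF : bigOn 3 (fun h => \sum_j central_inv2 (phase kx h) k j * res 2 kx j h).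
  apply: bigO_sum => j; exact: bigOn_ratio (h_central_inv2 k j kx0) (residual2_bigO kx j).
apply: (bigOnM HF (m := 1)); apply: bigOD.
  exact: bigOn_weak (wave_mom_bigO l ky).
exact: bigOn_weak (residual2_bigO ky l).
Qed.

Definition proj2_modes : seq ('I_3 * 'I_3) :=
  [:: (2, 2); (2, 1); (2, 0); (1, 2); (1, 1); (1, 0); (0, 2); (0, 1); (0, 0)].

(* [w2] lists the modes [(k, l)] in decreasing lexicographic order. *)
Definition proj2_index (k l : 'I_3) : 'I_9 := inord ((2 - k) * 3 + (2 - l)).

Lemma proj2_sum h q : proj2 a kx ky h q = \sum_(j < 9)
  (q (dof 1 (nth (0, 0) proj2_modes j).1 (nth (0, 0) proj2_modes j).2) 0 + a j * (h ^+ 3)%:C)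
    *: nth 0 (w2 h h kx ky) j.
Proof.
rewrite !big_ord_recr big_ord0 /= add0r /proj2.
by do ![congr (_ + _)]; congr ((_ + a _ * _) *: _); exact: val_inj.
Qed.

Lemma comp1_proj2 h q (k l : 'I_3) :
  comp 1 (proj2 a kx ky h q) k l = q (dof 1 k l) 0 + a (proj2_index k l) * (h ^+ 3)%:C.
Proof.
rewrite /proj2 /w2 /= !compD !compZ !comp_kvec /= !(mx_entryD, mx_entryZ) !mxE.
have E (i i' j j' : 'I_3) (m : 'I_9) : i = i' -> j = j' -> m = proj2_index i' j' ->
    q (dof 1 i j) 0 + a m * (h ^+ 3)%:C = q (dof 1 i' j') 0 + a (proj2_index i' j') * (h ^+ 3)%:C.
  by move=> -> -> ->.
case: k l => [[|[|[|//]]] ik] [[|[|[|//]]] il] /=; rewrite ?(mulr0, mulr1, addr0, add0r).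
all: apply: E; apply: val_inj; rewrite //= /proj2_index inordK//.
Qed.

Lemma proj2_affine h : affine_map (proj2 a kx ky h).
Proof.
pose m j := dof 1 (nth (0, 0) proj2_modes j).1 (nth (0, 0) proj2_modes j).2 : 'I_(ndof 2).
pose w j := nth 0 (w2 h h kx ky) j.
exists (\sum_(j < 9) w j *m (delta_mx 0 (m j) : 'rV_(ndof 2))).
exists (\sum_(j < 9) (a j * (h ^+ 3)%:C) *: w j) => q.
rewrite proj2_sum mulmx_suml -big_split/=; apply: eq_bigr => j _.
rewrite scalerDl -mulmxA; congr (_ + _).
have -> : (delta_mx 0 (m j) : 'rV_(ndof 2)) *m q = (q (m j) 0)%:M.
  apply/matrixP => x y; rewrite !ord1 mxE [RHS]mxE eqxx mulr1n (bigD1 (m j))//=.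
  rewrite mxE !eqxx mul1r big1 ?addr0// => i im.
  by rewrite mxE (negPf im) andbF mul0r.
by rewrite mul_mx_scalar.
Qed.

Lemma card_v_entries K : #|v_entries K| = (K.+1 * K.+1)%N.
Proof.
have -> : v_entries K = [set dof 1 x.1 x.2 | x : 'I_K.+1 * 'I_K.+1].
  apply/setP; apply: dof_ind => c k l; rewrite inE field_of_dof.
  apply/eqP/imsetP => [->|[[i j] _ /(congr1 (@field_of K))]]; first by exists (k, l).
  by rewrite !field_of_dof.
rewrite card_imset ?card_prod ?card_ord// => -[i j] [i' j'] /= E.
have := congr1 (@xmode K) E; have := congr1 (@ymode K) E.
by rewrite !xmode_dof !ymode_dof => /val_inj -> /val_inj ->.
Qed.

Lemma proj2_steady h q : 0 < h -> regular_mode 2 (phase kx h) ->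
  proj2 a kx ky h q \in steadyh 2 kx ky h.
Proof.
move=> h0 reg; rewrite (steady_w2 hb ky h0 h0 reg) proj2_sum.
by rewrite rpred_sum// => j _; rewrite rpredZ// memv_span// mem_nth.
Qed.

Lemma proj2_optimal : selectively_optimal (fun h => steadyh 2 kx ky h) (v_entries 2)
  (proj2 a kx ky).
Proof.
split.
- apply: filterS2 (near0_gt0 R) (near_regular 2 kx0) => h h0 reg.
  by rewrite card_v_entries (dim_steady hb h0 h0 (or_introl reg)).
- apply: filterS2 (near0_gt0 R) (near_regular 2 kx0) => h h0 reg.
  by split; [exact: proj2_affine|move=> q; exact: proj2_steady].
- move=> q; apply: dof_ind => c k l; rewrite inE field_of_dof => /eqP ->.
  apply/scal_bigO_nat; apply: eq_bigO (bigO_cM (a (proj2_index k l)) (bigOn_X R 3)).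
  apply: nearW => h; have := comp1_proj2 h q k l; rewrite mxE => ->.
  by rewrite rmorphXn addrC addKr.
Qed.

(* [X s] is of order 1 / h, so the unbounded vectors are those of [a 6] and [a 7]. *)
Lemma proj2_third_order : a 6 = 0 -> a 7 = 0 ->
  vec_bigO (fun h => DOF b 2 h h kx ky - proj2 a kx ky h (DOF b 2 h h kx ky)) 3.
Proof.
move=> a6 a7; pose D h := DOF b 2 h h kx ky; pose E h := D h - proj2 a kx ky h (D h).
have Ev (k l : 'I_3) h : E h (dof 1 k l) 0 = - (a (proj2_index k l) * h%:C ^+ 3).
  have := comp1_proj2 h (D h) k l; rewrite mxE /E mx_entryD mx_entryN => ->.
  by rewrite rmorphXn opprD addNKr.
elim/dof_ind => c k l; apply/scal_bigO_nat; elim/ord3_ind: c.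
- have H1 : bigOn 3 (fun h => \sum_i \sum_j central_inv2 (phase kx h) k i *
      central_mx b 2 (phase ky h) l j * E h (dof 1 i j) 0).
    apply: bigO_sum => i; apply: bigO_sum => j.
    have fin f : bigOn 0 f -> bigOn 3 (fun h => f h * E h (dof 1 i j) 0).
      move=> Hf; have := bigOnM Hf (bigO_cM (- a (proj2_index i j)) (bigOn_X R 3)).
      by apply: eq_bigO; apply: nearW => h; rewrite Ev mulNr.
    have [i0|i0] := eqVneq i 0; last first.
      exact: fin (bigOnM (central_inv2_bigO kx k i0) (central_bigO b ky l j)).
    (* For mode (0, 0) the pole X meets column 0 of the y-matrix, which is O(h); this is why [a 8]
       may be arbitrary. *)
    have [j0|j0] := eqVneq j 0.
      apply: fin; rewrite j0; exact: bigOn_ratio (h_central_inv2 k i kx0) (central_col0 hb ky l).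
    have a0 : a (proj2_index i j) = 0.
      rewrite i0 {fin}; case: j j0 => [[|[|[|//]]] ij] // _.
      + by rewrite (_ : proj2_index _ _ = 7)//; apply: val_inj; rewrite /= /proj2_index inordK.
      + by rewrite (_ : proj2_index _ _ = 6)//; apply: val_inj; rewrite /= /proj2_index inordK.
    apply: eq_bigO (bigO0 _); apply: nearW => h.
    by rewrite Ev a0 mul0r oppr0 mulr0.
  apply: eq_bigO (bigOB (second_order_terms k l) H1).
  apply: filterS2 (near0_gt0 R) (near_regular 2 kx0) => h h0 reg.
  have /andP[t1 t2] := reg.
  have AB := mul_central_inv2 hb (expi_neq0 _) t1 t2.
  by rewrite [RHS](error_decomposition hb k l h0 kx0 reg AB (proj2_steady (D h) h0 reg)).
- have := bigO_cM (- a (proj2_index k l)) (bigOn_X R 3).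
  by apply: eq_bigO; apply: nearW => h; rewrite mulNr -Ev.
- apply: eq_bigO (bigO0 _).
  apply: filterS2 (near0_gt0 R) (near_regular 2 kx0) => h h0 reg.
  rewrite mx_entryD mx_entryN DOF_comp// Qhat2 mul0r.
  have [/matrixP/(_ k l) + _] := (mem_steadyD hb h0 h0 _ (or_introl reg)).1 (proj2_steady (D h) h0 reg).
  by rewrite !mxE => ->; rewrite subrr.
Qed.

End DegreeTwo.
End LowDegrees.

Theorem mainTheorem7 (R : realType) (b : nat -> {poly R})
    (hb : orthonormal_basis b) :
  (* kernel, any degree *)
  (forall (K : nat) (dx dy kx ky : R), 0 < dx -> 0 < dy ->
     regular_mode K (expi (kx * dx)) \/ regular_mode K (expi (ky * dy)) ->
     steady b K (Dp R) (Dp R) dx dy kx ky = steady b K 0 0 dx dy kx ky /\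
     \dim (steady b K (Dp R) (Dp R) dx dy kx ky) = (K.+1 ^ 2)%N)
  /\
  (* K = 1 *)
  ((forall dx dy kx ky : R, 0 < dx -> 0 < dy ->
      regular_mode 1 (expi (kx * dx)) ->
      steady b 1 (Dp R) (Dp R) dx dy kx ky = <<w1 dx dy kx ky>>%VS)
   /\
   (forall (kx ky : R) (P : R -> 'cV[R[i]]_(ndof 1) -> 'cV[R[i]]_(ndof 1)),
      kx != 0 ->
      selectively_optimal (fun h => steady b 1 (Dp R) (Dp R) h h kx ky)
        (v_entries 1) P ->
      vec_bigO (fun h => DOF b 1 h h kx ky - P h (DOF b 1 h h kx ky)
                         - leading1 kx ky h) 2)
   /\
   (forall (kx ky : R) (I : {set 'I_(ndof 1)})
      (P : R -> 'cV[R[i]]_(ndof 1) -> 'cV[R[i]]_(ndof 1)) (p : R),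
      kx != 0 -> ky != 0 ->
      selectively_optimal (fun h => steady b 1 (Dp R) (Dp R) h h kx ky) I P ->
      1 < p ->
      ~ vec_bigO (fun h => DOF b 1 h h kx ky - P h (DOF b 1 h h kx ky)) p))
  /\
  (* K = 2 *)
  ((forall dx dy kx ky : R, 0 < dx -> 0 < dy ->
      regular_mode 2 (expi (kx * dx)) ->
      steady b 2 (Dp R) (Dp R) dx dy kx ky = <<w2 dx dy kx ky>>%VS)
   /\
   (forall (kx ky : R) (a : 'I_9 -> R[i]), kx != 0 ->
      selectively_optimal (fun h => steady b 2 (Dp R) (Dp R) h h kx ky)
        (v_entries 2) (proj2 a kx ky) /\
      (a 6 = 0 -> a 7 = 0 ->
       vec_bigO (fun h => DOF b 2 h h kx ky
                          - proj2 a kx ky h (DOF b 2 h h kx ky)) 3))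
   /\
   (forall kx ky : R, kx != 0 ->
      exists (I : {set 'I_(ndof 2)})
        (P : R -> 'cV[R[i]]_(ndof 2) -> 'cV[R[i]]_(ndof 2)),
        selectively_optimal (fun h => steady b 2 (Dp R) (Dp R) h h kx ky) I P /\
        vec_bigO (fun h => DOF b 2 h h kx ky - P h (DOF b 2 h h kx ky)) 3))
  /\
  (* K = 3 *)
  (forall (kx ky : R) (I : {set 'I_(ndof 3)})
     (P : R -> 'cV[R[i]]_(ndof 3) -> 'cV[R[i]]_(ndof 3)) (p : R),
     kx != 0 -> ky != 0 ->
     selectively_optimal (fun h => steady b 3 (Dp R) (Dp R) h h kx ky) I P ->
     3 < p ->
     ~ vec_bigO (fun h => DOF b 3 h h kx ky - P h (DOF b 3 h h kx ky)) p).
Proof.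
split=> [K dx dy kx ky dx0 dy0 reg|].
  by split; [exact: steady_Dp_eq0|exact: dim_steady].
split; [split=> [dx dy kx ky dx0 dy0 reg|]|split].
- exact: steady_w1.
- split=> [kx ky P kx0 so|kx ky I P p kx0 ky0 [_ PS _] p1]; first exact: first_order_error.
  apply: no_higher_order => //.
  by apply: filterS PS => h [].
- split=> [dx dy kx ky dx0 dy0 reg|]; first exact: steady_w2.
  split=> [kx ky a kx0|kx ky kx0].
    by split=> [|a6 a7]; [exact: proj2_optimal|exact: proj2_third_order].
  exists (v_entries 2), (proj2 (fun=> 0) kx ky).
  by split; [exact: proj2_optimal|exact: proj2_third_order].
- move=> kx ky I P p kx0 ky0 [_ PS _] p3; apply: no_higher_order => //.
  by apply: filterS PS => h [].
Qed.
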